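(* Let $G\le S_8$ and $H\le S_{14}$ be the two permutation groups of order $1344$ given in the context, and for each integer $k\ge 1$ let $\mathfrak{A}_G^{(k)}$ and $\mathfrak{A}_H^{(k)}$ be the centralizer algebras of the $k$-th tensor powers of their permutation representations. Define $$a_{G,k}=\tfrac{2^{3k}}{1344}+\tfrac{2^{2k}}{32}+\tfrac{7}{24}2^{k}+\tfrac{2}{7},\qquad b_{G,k}=c_{G,k}=\tfrac{2^{3k}}{448}-\tfrac{2^{2k}}{32}+\tfrac{2^{k}}{8}-\tfrac{1}{7},$$ $$d_{G,k}=\tfrac{2^{3k}}{224}+\tfrac{2^{2k}}{16}-\tfrac{2}{7},\qquad e_{G,k}=g_{G,k}=\tfrac{2^{3k}}{192}-\tfrac{2^{2k}}{32}+\tfrac{2^{k}}{24},\qquad f_{G,k}=\tfrac{2^{3k}}{168}-\tfrac{2^k}{6}+\tfrac{2}{7},$$ $$h_{G,k}=\tfrac{2^{3k}}{192}+\tfrac{3}{32}2^{2k}+\tfrac{7}{24}2^{k},\qquad i_{G,k}=\tfrac{2^{3k}}{96}+\tfrac{2^{2k}}{16}-\tfrac{2^k}{6},$$ $$j_{G,k}=\tfrac{2^{3k}}{64}-\tfrac{3}{32}2^{2k}+\tfrac{2^{k}}{8},\qquad l_{G,k}=\tfrac{2^{3k}}{64}+\tfrac{2^{2k}}{32}-\tfrac{2^{k}}{8},$$ and $$a_{H,k}=2^k\left(\tfrac{1}{1344}7^k+\tfrac{7}{192}3^k+\tfrac{37}{96}\right),\qquad b_{H,k}=c_{H,k}=2^k\left(\tfrac{1}{448}7^k-\tfrac{1}{64}3^k+\tfrac{1}{32}\right),$$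 $$d_{H,k}=2^k\left(\tfrac{1}{224}7^k+\tfrac{3}{32}3^k+\tfrac{3}{16}\right),\qquad e_{H,k}=2^k\left(\tfrac{1}{192}7^k+\tfrac{1}{192}3^k-\tfrac{5}{96}\right),$$ $$f_{H,k}=2^k\left(\tfrac{1}{168}7^k+\tfrac{1}{24}3^k-\tfrac{1}{6}\right),\qquad g_{H,k}=2^k\left(\tfrac{1}{192}7^k+\tfrac{17}{192}3^k+\tfrac{19}{96}\right),$$ $$h_{H,k}=2^k\left(\tfrac{1}{192}7^k-\tfrac{7}{192}3^k+\tfrac{7}{96}\right),\qquad i_{H,k}=2^k\left(\tfrac{1}{96}7^k+\tfrac{5}{96}3^k-\tfrac{11}{48}\right),$$ $$j_{H,k}=2^k\left(\tfrac{1}{64}7^k+\tfrac{1}{64}3^k-\tfrac{5}{32}\right),\qquad l_{H,k}=2^k\left(\tfrac{1}{64}7^k-\tfrac{7}{64}3^k+\tfrac{7}{32}\right).$$ Then, as $\mathbb{C}$-algebras, $$\mathfrak{A}_G^{(k)}\cong\begin{cases}2M_1 & (k=1),\\ M_{a_{G,k}}\oplus 2M_{b_{G,k}}\oplus M_{d_{G,k}}\oplus 2M_{e_{G,k}}\oplus M_{f_{G,k}}\oplus M_{h_{G,k}}\oplus M_{i_{G,k}}\oplus M_{j_{G,k}}\oplus M_{l_{G,k}} & (k\ge 2),\end{cases}$$ and $$\mathfrak{A}_H^{(k)}\cong\begin{cases}3M_1 & (k=1),\\ M_{a_{H,k}}\oplus 2M_{b_{H,k}}\oplus M_{d_{H,k}}\oplus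 M_{e_{H,k}}\oplus M_{f_{H,k}}\oplus M_{g_{H,k}}\oplus M_{h_{H,k}}\oplus M_{i_{H,k}}\oplus M_{j_{H,k}}\oplus M_{l_{H,k}} & (k\ge 2).\end{cases}$$
   Context: $G$ is the subgroup of the symmetric group $S_8$ generated by $(5,7)(6,8)$, $(2,3,5)(4,7,6)$, $(1,2)(3,4)(5,6)(7,8)$ and $(1,5)(2,6)(3,7)(4,8)$. $H$ is the subgroup of the symmetric group $S_{14}$ generated by $(1,2,3,4,5,6,7)(14,13,12,11,10,9,8)$ and $(1,4,7,9,14,11,8,6)(2,5,13,10)$. Both groups have order $1344$. For $k\ge1$, $\mathfrak{A}_G^{(k)}=\mathrm{End}_{G}\big((\mathbb{C}^{8})^{\otimes k}\big)$ is the algebra of all $\mathbb{C}$-linear endomorphisms of $(\mathbb{C}^{8})^{\otimes k}$ commuting with the diagonal action of $G$, where $G$ acts on $\mathbb{C}^8$ by permuting the standard basis. Likewise $\mathfrak{A}_H^{(k)}=\mathrm{End}_{H}\big((\mathbb{C}^{14})^{\otimes k}\big)$, with $H$ acting on $\mathbb{C}^{14}$ by permuting the standard basis. $M_d$ denotes the algebra of $d\times d$ matrices over $\mathbb{C}$, with $M_0=0$ (a summand of degree $0$ is omitted), and $nM_d$ denotes the direct sum $M_d\oplus\cdots\oplus M_d$ of $n$ copies of $M_d$. *)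

(* Defs.v *)
From HB Require Import structures.
From mathcomp Require Import all_boot all_order all_algebra.
From mathcomp Require Import all_fingroup all_character.
From mathcomp Require Import reals.
From mathcomp Require Import complex mxtens.

Set Implicit Arguments.
Unset Strict Implicit.
Unset Printing Implicit Defensive.

Import GRing.Theory.

(* The cycle (c_1, ..., c_m) on the points 1, ..., n.+1, for a list c of       *)
(* distinct labels; the point with label x is the ordinal x.-1 of 'I_n.+1.     *)
Definition cyc {n : nat} (c : seq nat) : 'S_n.+1 :=
  insubd (1%g : 'S_n.+1) [ffun x => next [seq inord i.-1 | i <- c] x].

Lemma cycE n (c : seq nat) (x : 'I_n.+1) :
  uniq [seq (inord i.-1 : 'I_n.+1) | i <- c] ->
  cyc c x = next [seq inord i.-1 | i <- c] x.
Proof.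
move=> Uc; rewrite /cyc -pvalE val_insubd ifT ?ffunE //.
by apply/injectiveP => y z; rewrite !ffunE; apply: (can_inj (prev_next Uc)).
Qed.

(* The product of disjoint cycles.                                            *)
Definition cycles {n : nat} (cs : seq (seq nat)) : 'S_n.+1 :=
  (\prod_(c <- cs) cyc c)%g.

Definition gens_G : {set 'S_8} :=
  [set cycles [:: [:: 5; 7]; [:: 6; 8]];
       cycles [:: [:: 2; 3; 5]; [:: 4; 7; 6]];
       cycles [:: [:: 1; 2]; [:: 3; 4]; [:: 5; 6]; [:: 7; 8]];
       cycles [:: [:: 1; 5]; [:: 2; 6]; [:: 3; 7]; [:: 4; 8]]].

Definition gens_H : {set 'S_14} :=
  [set cycles [:: [:: 1; 2; 3; 4; 5; 6; 7]; [:: 14; 13; 12; 11; 10; 9; 8]];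
       cycles [:: [:: 1; 4; 7; 9; 14; 11; 8; 6]; [:: 2; 5; 13; 10]]].

Definition group_G : {group 'S_8} := <<gens_G>>%G.
Definition group_H : {group 'S_14} := <<gens_H>>%G.

Local Open Scope ring_scope.

Section MatrixSum.
Variables (K : comPzRingType) (ds : seq nat).

(* M_{d_1} (+) ... (+) M_{d_m} for ds = [:: d_1; ...; d_m], with componentwise *)
(* operations. 'M_0 is the zero algebra, so that a degree 0 contributes        *)
(* nothing. As sums involving 'M_0 may be trivial, this is only a pzRingType   *)
(* and an lmodType (an algType would require 1 != 0).                          *)
Definition matsum : Type :=
  {dffun forall i : 'I_(size ds), 'M[K]_(nth 0%N ds i)}.
HB.instance Definition _ := Choice.on matsum.

Implicit Types (u v : matsum) (a : K).

Definition matsum_zero : matsum := [ffun i => 0].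
Definition matsum_one : matsum := [ffun i => 1%:M].
Definition matsum_opp u : matsum := [ffun i => - u i].
Definition matsum_add u v : matsum := [ffun i => u i + v i].
Definition matsum_mul u v : matsum := [ffun i => u i *m v i].
Definition matsum_scale a u : matsum := [ffun i => a *: u i].

Fact matsum_addA : associative matsum_add.
Proof. by move=> u v w; apply/ffunP => i; rewrite !ffunE addrA. Qed.
Fact matsum_addC : commutative matsum_add.
Proof. by move=> u v; apply/ffunP => i; rewrite !ffunE addrC. Qed.
Fact matsum_add0 : left_id matsum_zero matsum_add.
Proof. by move=> u; apply/ffunP => i; rewrite !ffunE add0r. Qed.
Fact matsum_addN : left_inverse matsum_zero matsum_opp matsum_add.
Proof. by move=> u; apply/ffunP => i; rewrite !ffunE addNr. Qed.
HB.instance Definition _ := GRing.isZmodule.Build matsum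
  matsum_addA matsum_addC matsum_add0 matsum_addN.

Fact matsum_mulA : associative matsum_mul.
Proof. by move=> u v w; apply/ffunP => i; rewrite !ffunE mulmxA. Qed.
Fact matsum_mul1l : left_id matsum_one matsum_mul.
Proof. by move=> u; apply/ffunP => i; rewrite !ffunE mul1mx. Qed.
Fact matsum_mul1r : right_id matsum_one matsum_mul.
Proof. by move=> u; apply/ffunP => i; rewrite !ffunE mulmx1. Qed.
Fact matsum_mulDl : left_distributive matsum_mul +%R.
Proof. by move=> u v w; apply/ffunP => i; rewrite !ffunE mulmxDl. Qed.
Fact matsum_mulDr : right_distributive matsum_mul +%R.
Proof. by move=> u v w; apply/ffunP => i; rewrite !ffunE mulmxDr. Qed.
HB.instance Definition _ := GRing.Zmodule_isPzRing.Build matsum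
  matsum_mulA matsum_mul1l matsum_mul1r matsum_mulDl matsum_mulDr.

Fact matsum_scaleA a b u :
  matsum_scale a (matsum_scale b u) = matsum_scale (a * b) u.
Proof. by apply/ffunP => i; rewrite !ffunE scalerA. Qed.
Fact matsum_scale1 : left_id 1 matsum_scale.
Proof. by move=> u; apply/ffunP => i; rewrite !ffunE scale1r. Qed.
Fact matsum_scaleDr : right_distributive matsum_scale +%R.
Proof. by move=> a u v; apply/ffunP => i; rewrite !ffunE scalerDr. Qed.
Fact matsum_scaleDl u : {morph matsum_scale^~ u : a b / a + b}.
Proof. by move=> a b; apply/ffunP => i; rewrite !ffunE scalerDl. Qed.
HB.instance Definition _ := GRing.Zmodule_isLmodule.Build K matsum
  matsum_scaleA matsum_scale1 matsum_scaleDr matsum_scaleDl.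

End MatrixSum.

Section Centralizer.
Variables (F : fieldType) (gT : finGroupType) (G : {group gT}) (n : nat).
Variable rG : mx_representation F G n.

(* The matrices commuting with all rG g, i.e. End_G of the module afforded by *)
(* rG. A matrix f stands for the endomorphism v |-> f *m v of 'cV_n, so that  *)
(* the product of matrices is composition.                                    *)
Record centralizer := Centralizer {
  centralizer_val :> 'M[F]_n;
  _ : centgmx rG centralizer_val
}.

HB.instance Definition _ := [isSub for centralizer_val].
HB.instance Definition _ := [Choice of centralizer by <:].

Fact centgmx_subring_closed : subring_closed (centgmx rG : pred 'M[F]_n).
Proof.
split=> [|A B|A B].
- by apply/centgmxP => x _; rewrite mul1mx mulmx1.
- move=> /centgmxP cA /centgmxP cB; apply/centgmxP => x Gx.
  by rewrite mulmxBl mulmxBr cA ?cB.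
- move=> /centgmxP cA /centgmxP cB; apply/centgmxP => x Gx.
  by rewrite -mulmxA cB // !mulmxA cA.
Qed.

Fact centgmx_scaler_closed : GRing.scaler_closed (centgmx rG : pred 'M[F]_n).
Proof.
move=> a A /centgmxP cA; apply/centgmxP => x Gx.
by rewrite -scalemxAl -scalemxAr cA.
Qed.

HB.instance Definition _ := GRing.isSubringClosed.Build 'M[F]_n
  (centgmx rG : pred 'M[F]_n) centgmx_subring_closed.
HB.instance Definition _ := GRing.isScaleClosed.Build F 'M[F]_n
  (centgmx rG : pred 'M[F]_n) centgmx_scaler_closed.
HB.instance Definition _ := GRing.SubChoice_isSubPzRing.Build 'M[F]_n
  (centgmx rG : pred 'M[F]_n) centralizer centgmx_subring_closed.
HB.instance Definition _ := [SubZmodule_isSubLmodule of centralizer by <:].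

(* Isomorphism of unital F-algebras. *)
Definition centralizer_iso_matsum (ds : seq nat) : Prop :=
  exists phi : centralizer -> matsum F ds,
    [/\ linear phi, GRing.monoid_morphism phi & bijective phi].

End Centralizer.

Section TensorPower.
Variables (F : fieldType) (n : nat) (G : {group 'S_n}) (k : nat).

(* perm_mx s permutes the standard basis of F^n. Its k-fold Kronecker power   *)
(* perm_mx s ^t k is the diagonal action of s on the k-th tensor power of F^n *)
(* in the basis of pure tensors of standard basis vectors. As perm_mx follows *)
(* the row convention e_i *m perm_mx s = e_(s i), it acts on columns as s^-1; *)
(* a group being closed under inverses, the commutant is the same.            *)
Definition tens_perm_mx (s : 'S_n) : 'M[F]_(n ^ k) := perm_mx s ^t k.

Fact tens_perm_mx_repr : mx_repr G tens_perm_mx.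
Proof.
have tens1 m p : 1%:M *t 1%:M = 1%:M :> 'M[F]_(m * p).
  apply/matrixP => i j; case: (mxtens_indexP i) => i0 i1.
  case: (mxtens_indexP j) => j0 j1; rewrite tensmxE !mxE -natrM mulnb.
  by rewrite (can_eq (@mxtens_indexK m p)) xpair_eqE.
rewrite /tens_perm_mx; split=> [|s t _ _].
  rewrite perm_mx1; case: k => [|j] //.
  by elim: j => [|j IHj] //; rewrite ntensmxSS IHj tens1.
rewrite perm_mxM; case: k => [|j]; first by rewrite !ntensmx0 mul1mx.
by elim: j => [|j IHj] //; rewrite !ntensmxSS IHj tensmx_mul.
Qed.

Definition tens_perm_repr := MxRepresentation tens_perm_mx_repr.

End TensorPower.

Section Multiplicities.
Variable k : nat.

Definition aG : rat := 2 ^+ (3 * k) / 1344 + 2 ^+ (2 * k) / 32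
                       + 7 / 24 * 2 ^+ k + 2 / 7.
Definition bG : rat := 2 ^+ (3 * k) / 448 - 2 ^+ (2 * k) / 32
                       + 2 ^+ k / 8 - 1 / 7.
Definition cG : rat := bG.
Definition dG : rat := 2 ^+ (3 * k) / 224 + 2 ^+ (2 * k) / 16 - 2 / 7.
Definition eG : rat := 2 ^+ (3 * k) / 192 - 2 ^+ (2 * k) / 32 + 2 ^+ k / 24.
Definition fG : rat := 2 ^+ (3 * k) / 168 - 2 ^+ k / 6 + 2 / 7.
Definition gG : rat := eG.
Definition hG : rat := 2 ^+ (3 * k) / 192 + 3 / 32 * 2 ^+ (2 * k)
                       + 7 / 24 * 2 ^+ k.
Definition iG : rat := 2 ^+ (3 * k) / 96 + 2 ^+ (2 * k) / 16 - 2 ^+ k / 6.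
Definition jG : rat := 2 ^+ (3 * k) / 64 - 3 / 32 * 2 ^+ (2 * k) + 2 ^+ k / 8.
Definition lG : rat := 2 ^+ (3 * k) / 64 + 2 ^+ (2 * k) / 32 - 2 ^+ k / 8.

Definition degG : seq rat := [:: aG; bG; cG; dG; eG; gG; fG; hG; iG; jG; lG].

Definition aH : rat := 2 ^+ k * (1 / 1344 * 7 ^+ k + 7 / 192 * 3 ^+ k + 37 / 96).
Definition bH : rat := 2 ^+ k * (1 / 448 * 7 ^+ k - 1 / 64 * 3 ^+ k + 1 / 32).
Definition cH : rat := bH.
Definition dH : rat := 2 ^+ k * (1 / 224 * 7 ^+ k + 3 / 32 * 3 ^+ k + 3 / 16).
Definition eH : rat := 2 ^+ k * (1 / 192 * 7 ^+ k + 1 / 192 * 3 ^+ k - 5 / 96).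
Definition fH : rat := 2 ^+ k * (1 / 168 * 7 ^+ k + 1 / 24 * 3 ^+ k - 1 / 6).
Definition gH : rat := 2 ^+ k * (1 / 192 * 7 ^+ k + 17 / 192 * 3 ^+ k + 19 / 96).
Definition hH : rat := 2 ^+ k * (1 / 192 * 7 ^+ k - 7 / 192 * 3 ^+ k + 7 / 96).
Definition iH : rat := 2 ^+ k * (1 / 96 * 7 ^+ k + 5 / 96 * 3 ^+ k - 11 / 48).
Definition jH : rat := 2 ^+ k * (1 / 64 * 7 ^+ k + 1 / 64 * 3 ^+ k - 5 / 32).
Definition lH : rat := 2 ^+ k * (1 / 64 * 7 ^+ k - 7 / 64 * 3 ^+ k + 7 / 32).

Definition degH : seq rat := [:: aH; bH; cH; dH; eH; fH; gH; hH; iH; jH; lH].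

End Multiplicities.

(* Main.v *)
Require Import Defs.
From Stdlib Require Import ZArith.
From mathcomp Require Import all_boot all_order all_algebra all_fingroup.
From mathcomp Require Import all_solvable all_character.
From mathcomp Require Import reals complex mxtens ring ssrZ.

(* The commutant of a representation V of a finite group over an algebraically  *)
(* closed field of characteristic 0 is the sum over the irreducible W of the    *)
(* matrix algebras of size m_W, the multiplicity of W in V: by Schur            *)
(* orthogonality the matrix coefficients of the W give matrix units e^W_ab      *)
(* acting on V, an f in the commutant is determined by its restrictions to the  *)
(* images of the idempotents e^W_00, and these have dimension                   *)
(*   m_W = tr e^W_00 = #|G|^-1 \sum_g chi_W(g^-1) chi_V(g).                     *)
(* For the tensor power of a permutation representation, chi_V(g) is the k-th   *)
(* power of the number of fixed points of g, so that only the character tables  *)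
(* of the two groups are needed. A table t_1, ..., t_r of class functions is    *)
(* the character table as soon as r is the number of classes, t_i(1) = d_i > 0, *)
(*   t_i * t_j = (i == j) #|G| / d_i t_i  and  \sum_i d_i t_i = #|G| delta_1:   *)
(* the (d_i / #|G|) t_i are then orthogonal central idempotents of the group    *)
(* algebra with sum 1, hence the r primitive ones. For the groups of order 1344 *)
(* these identities are verified by enumeration. Both have 11 classes, and      *)
(* their characters take values in Z[alpha], alpha^2 + alpha + 2 = 0.           *)

Set Implicit Arguments.
Unset Strict Implicit.
Unset Printing Implicit Defensive.

Import GRing.Theory Num.Theory.

Local Open Scope ring_scope.

Local Arguments irr_repr : simpl never.

(** * Matrix units attached to the irreducible representations *)

(** By complete reducibility V is the direct sum of the tensor products of W with a multiplicity
    space of dimension m_W, and by Schur's lemma an operator commuting with G acts on the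
    multiplicity spaces only. [centralizer_iso] makes this concrete: the image of the unit e^W_00 is
    the multiplicity space of W, restriction to these images is the isomorphism, and the units
    e^W_a0 and e^W_0a copy a block back to all of V.

    In a tensor power an element with f fixed points has trace f^k, so m_W is a fixed combination of
    the powers f^k, whose coefficients are sums of the character of W over the elements with f fixed
    points ([data_multiplicities]). This is where the closed formulas come from.

    The characters are supplied as a candidate table, recognized by [character_table_irreducible].
    Its hypotheses are finite identities: they are computed on lists coding the permutations
    ([data_G_ok], [data_H_ok]) and carried over to the groups by [group_checkP] and
    [table_char_irreducible]. *)

Section IrreducibleRepresentations.
Variables (F : numClosedFieldType) (gT : finGroupType) (G : {group gT}).

Definition irreps : irrType F G := DecSocleType (regular_repr F G).
Implicit Types W : irreps.

Lemma pchar'_group : ([pchar F]^'.-group G)%g.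
Proof.
by apply: sub_in_pnat (pnat_pi (cardG_gt0 G)) => p _ _; rewrite inE /= pchar_num.
Qed.

Let splitG : group_splitting_field F G := @group_closure_closed_field F gT G.

Lemma natG_neq0 : (#|G|%:R : F) != 0.
Proof. by rewrite pnatr_eq0 -lt0n cardG_gt0. Qed.

Lemma degree_neq0 W : ((irr_degree W)%:R : F) != 0.
Proof. by rewrite pnatr_eq0 -lt0n irr_degree_gt0. Qed.

Lemma irreps_count : #|{: irreps}| = #|classes G|.
Proof. exact: card_irr_pchar pchar'_group splitG. Qed.

(** Multiplication by g != 1 fixes no basis vector of the regular module. *)
Lemma regular_trace g : g \in G ->
  \tr (regular_mx F G g) = (g == 1%g)%:R * #|G|%:R.
Proof.
move=> Gg; rewrite /mxtrace.
rewrite (eq_bigr (fun=> (g == 1%g)%:R : F)) => [|i _].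
  by rewrite sumr_const card_ord mulr_natr.
rewrite !mxE eqxx /=; congr (_%:R); congr nat_of_bool.
apply/eqP/eqP => [|->]; last by rewrite mulg1 gring_valK.
move/(congr1 enum_val); rewrite gring_indexK ?groupM ?enum_valP // => e.
by apply: (mulgI (enum_val i)); rewrite -e mulg1.
Qed.

Lemma sum_degree_trace g : g \in G ->
  \sum_(W : irreps) (irr_degree W)%:R * \tr (irr_repr W g) = (g == 1%g)%:R * #|G|%:R :> F.
Proof.
move=> Gg; rewrite -regular_trace // (mxtrace_regular_pchar irreps pchar'_group) //.
by apply: eq_bigr => W _; rewrite mulr_natl.
Qed.

(** Averaging over the group, without the factor 1/|G|: whatever X is, the result intertwines [r1]
    and [r2]. *)
Definition intertwining_sum n1 n2 (r1 : mx_representation F G n1)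
  (r2 : mx_representation F G n2) (X : 'M[F]_(n1, n2)) : 'M_(n1, n2) :=
  \sum_(g in G) r1 g^-1%g *m X *m r2 g.

Lemma intertwining_sumP n1 n2 (r1 : mx_representation F G n1)
    (r2 : mx_representation F G n2) X h : h \in G ->
  r1 h *m intertwining_sum r1 r2 X = intertwining_sum r1 r2 X *m r2 h.
Proof.
move=> Gh; rewrite mulmx_sumr mulmx_suml.
rewrite [RHS](reindex_inj (mulIg h^-1%g)) /=.
apply: eq_big => [g | g Gg]; first by rewrite groupMr ?groupV.
rewrite -!mulmxA -[in RHS]repr_mxM ?groupM ?groupV // mulgKV.
by rewrite invMg invgK repr_mxM ?groupV // !mulmxA.
Qed.

(** Schur's lemma: the kernel and image of an intertwiner are submodules, so a nonzero one would
    make W and W' isomorphic. *)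
Lemma intertwining_sum0 W W' X : W != W' ->
  intertwining_sum (irr_repr W) (irr_repr W') X = 0.
Proof.
move=> neqW; set T := intertwining_sum _ _ _.
have TJ h : h \in G -> irr_repr W h *m T = T *m irr_repr W' h.
  exact: intertwining_sumP.
have [_ irrW] := (mx_irrP _).1 (socle_irr W).
have [_ irrW'] := (mx_irrP _).1 (socle_irr W').
apply: contraNeq neqW => nzT; apply/socle_rsimP.
have freeT : row_free T.
  rewrite -kermx_eq0; apply: contraNT nzT => /irrW full.
  have /full/row_fullP[B BK] : mxmodule (irr_repr W) (kermx T).
    apply/mxmoduleP => h Gh; apply/sub_kermxP.
    by rewrite -mulmxA TJ // mulmxA mulmx_ker mul0mx.
  by rewrite -[T]mul1mx -BK -mulmxA mulmx_ker mulmx0.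
have fullT : row_full T.
  have : <<T>>%MS != 0 by rewrite -mxrank_eq0 genmxE mxrank_eq0.
  rewrite -[row_full T]sub1mx -(genmxE T) sub1mx; apply: irrW'.
  apply/mxmoduleP => h Gh.
  rewrite (eqmxMr _ (genmxE _)) genmxE -TJ //; exact: submxMl.
have eq_n : irr_degree W = irr_degree W'.
  by rewrite -(eqnP freeT); apply/eqnP.
by exists T.
Qed.

(** Schur's lemma over a splitting field makes the average scalar; every summand has trace [\tr X],
    which determines the scalar. *)
Lemma intertwining_sum_scalar W (X : 'M[F]_(irr_degree W)) :
  intertwining_sum (irr_repr W) (irr_repr W) X
    = (\tr X * (#|G|%:R / (irr_degree W)%:R))%:M.
Proof.
set T := intertwining_sum _ _ _.
have /is_scalar_mxP[c Tc] : is_scalar_mx T.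
  apply: mx_abs_irr_cent_scalar (splitG (socle_irr W)) _ _.
  by apply/centgmxP => h Gh; rewrite intertwining_sumP.
rewrite Tc; congr (_%:M).
apply: (mulIf (degree_neq0 W)); rewrite mulrA divfK ?degree_neq0 //.
rewrite mulr_natr -mxtrace_scalar -Tc linear_sum /=.
rewrite (eq_bigr (fun=> \tr X)) ?sumr_const ?mulr_natr // => g Gg.
by rewrite mxtrace_mulC mulmxA -repr_mxM ?groupV // mulgV repr_mx1 mul1mx.
Qed.

Lemma delta_sandwich m n p q (A : 'M[F]_(m, n)) (B : 'M[F]_(p, q)) j k i l :
  (A *m delta_mx j k *m B) i l = A i j * B k l.
Proof.
rewrite mxE (bigD1 k) //= big1 ?addr0 => [|x /negPf nx]; last first.
  by rewrite mxE big1 ?mul0r // => y _; rewrite mxE nx andbF mulr0.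
rewrite mxE (bigD1 j) //= mxE !eqxx mulr1 big1 ?addr0 // => x /negPf nx.
by rewrite mxE nx mulr0.
Qed.

Lemma schur_orthogonality W i j k l :
  \sum_(g in G) irr_repr W g^-1%g i j * irr_repr W g k l
    = ((j == k) && (i == l))%:R * (#|G|%:R / (irr_degree W)%:R).
Proof.
transitivity (intertwining_sum (irr_repr W) (irr_repr W) (delta_mx j k) i l).
  by rewrite summxE; apply: eq_bigr => g _; rewrite delta_sandwich.
rewrite intertwining_sum_scalar mxE -mulrnAl; congr (_ * _).
rewrite /mxtrace (bigD1 j) //= mxE eqxx big1 ?addr0 => [|x /negPf nx].
  by rewrite -mulrnA mulnb.
by rewrite mxE nx.
Qed.

Lemma schur_orthogonality0 W W' i j k l : W != W' ->
  \sum_(g in G) irr_repr W g^-1%g i j * irr_repr W' g k l = 0.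
Proof.
move=> neqW.
transitivity (intertwining_sum (irr_repr W) (irr_repr W') (delta_mx j k) i l).
  by rewrite summxE; apply: eq_bigr => g _; rewrite delta_sandwich.
by rewrite intertwining_sum0 // mxE.
Qed.

Section MatrixUnits.
Variables (N : nat) (rV : mx_representation F G N).

(** The image in End(V) of the group algebra element that the Wedderburn isomorphism sends to the
    elementary matrix E_ab of the block of W. *)
Definition mxunit W (a b : 'I_(irr_degree W)) : 'M[F]_N :=
  ((irr_degree W)%:R / #|G|%:R) *: \sum_(g in G) irr_repr W g^-1%g b a *: rV g.

Lemma mxunit_mull W a b h : h \in G ->
  rV h *m mxunit a b = \sum_c irr_repr W h c a *: mxunit c b.
Proof.
move=> Gh; rewrite -scalemxAr mulmx_sumr.
under [RHS]eq_bigr do rewrite /mxunit scalerA mulrC -scalerA scaler_sumr.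
rewrite -scaler_sumr exchange_big /=; congr (_ *: _).
rewrite (reindex_inj (mulgI h^-1%g)) /=.
apply: eq_big => [g | g Gg]; first by rewrite groupMl ?groupV.
have {}Gg : g \in G by rewrite groupMl ?groupV in Gg.
rewrite -scalemxAr -repr_mxM ?groupM ?groupV // mulKVg invMg invgK.
rewrite repr_mxM ?groupV // mxE scaler_suml; apply: eq_bigr => c _.
by rewrite scalerA mulrC.
Qed.

Lemma mxunit_mulr W a b h : h \in G ->
  mxunit a b *m rV h = \sum_c irr_repr W h b c *: mxunit a c.
Proof.
move=> Gh; rewrite -scalemxAl mulmx_suml.
under [RHS]eq_bigr do rewrite /mxunit scalerA mulrC -scalerA scaler_sumr.
rewrite -scaler_sumr exchange_big /=; congr (_ *: _).
rewrite (reindex_inj (mulIg h^-1%g)) /=.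
apply: eq_big => [g | g Gg]; first by rewrite groupMr ?groupV.
have {}Gg : g \in G by rewrite groupMr ?groupV in Gg.
rewrite -scalemxAl -repr_mxM ?groupM ?groupV // mulgKV invMg invgK.
rewrite repr_mxM ?groupV // mxE scaler_suml; apply: eq_bigr => c _.
by rewrite scalerA.
Qed.

Lemma mxunitM W (a b c d : 'I_(irr_degree W)) :
  mxunit a b *m mxunit c d = (b == c)%:R *: mxunit a d.
Proof.
rewrite {1}/mxunit -scalemxAl mulmx_suml.
under eq_bigr => g Gg.
  rewrite -scalemxAl mxunit_mull // scaler_sumr.
  under eq_bigr do rewrite scalerA.
  over.
rewrite exchange_big /=.
under eq_bigr do rewrite -scaler_suml schur_orthogonality.
rewrite (bigD1 a) //= big1 ?addr0 => [|x nx]; last first.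
  by rewrite eq_sym (negPf nx) mul0r scale0r.
rewrite eqxx scalerA mulrCA [X in _ * X]mulrA divfK ?natG_neq0 //.
by rewrite divff ?degree_neq0 // mulr1.
Qed.

Lemma mxunitM0 W W' (a b : 'I_(irr_degree W)) (c d : 'I_(irr_degree W')) :
  W != W' -> mxunit a b *m mxunit c d = 0.
Proof.
move=> neqW; rewrite {1}/mxunit -scalemxAl mulmx_suml.
under eq_bigr => g Gg.
  rewrite -scalemxAl mxunit_mull // scaler_sumr.
  under eq_bigr do rewrite scalerA.
  over.
rewrite exchange_big /= big1 ?scaler0 // => x _.
by rewrite -scaler_suml schur_orthogonality0 // scale0r.
Qed.

(** Fourier inversion: once the sums are exchanged, the coefficient of [rV g] is the regular
    character at h g^-1 divided by |G|. *)
Lemma mxunit_span h : h \in G ->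
  rV h = \sum_(W : irreps) \sum_a \sum_b irr_repr W h a b *: mxunit a b.
Proof.
move=> Gh.
have entry (W : irreps) (a b : 'I_(irr_degree W)) :
    irr_repr W h a b *: mxunit a b = \sum_(g in G)
      ((irr_degree W)%:R / #|G|%:R * (irr_repr W h a b * irr_repr W g^-1%g b a))
        *: rV g.
  rewrite /mxunit scalerA mulrC -scalerA !scaler_sumr.
  by apply: eq_bigr => g Gg; rewrite !scalerA !mulrA.
under eq_bigr => W _.
  under eq_bigr => a _.
    under eq_bigr do rewrite entry.
    rewrite exchange_big /=.
    under eq_bigr do rewrite -scaler_suml -mulr_sumr.
    over.
  rewrite exchange_big /=.
  under eq_bigr => g Gg.
    rewrite -scaler_suml -mulr_sumr.
    have -> : \sum_a \sum_b irr_repr W h a b * irr_repr W g^-1%g b a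
              = \tr (irr_repr W (h * g^-1)%g).
      rewrite repr_mxM ?groupV // /mxtrace.
      by apply: eq_bigr => a _; rewrite mxE.
    rewrite mulrAC.
    over.
  over.
rewrite exchange_big /= (bigD1 h) //= [X in _ + X]big1 ?addr0.
  rewrite -scaler_suml -mulr_suml sum_degree_trace ?groupM ?groupV //.
  by rewrite mulgV eqxx mul1r divff ?natG_neq0 // scale1r.
move=> g /andP[Gg nhg].
rewrite -scaler_suml -mulr_suml sum_degree_trace ?groupM ?groupV //.
by rewrite -eq_mulgV1 eq_sym (negPf nhg) !mul0r scale0r.
Qed.

Lemma mxunit_sum1 : \sum_(W : irreps) \sum_(a < irr_degree W) mxunit a a = 1%:M.
Proof.
rewrite -(repr_mx1 rV) mxunit_span //; apply: eq_bigr => W _.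
apply: eq_bigr => a _; rewrite repr_mx1 (bigD1 a) //= mxE eqxx scale1r.
rewrite big1 ?addr0 // => b nb; by rewrite mxE eq_sym (negPf nb) scale0r.
Qed.

(** Since e_bb = e_ba e_ab and e_aa = e_ab e_ba, all diagonal units of W share the trace of their
    sum equally. *)
Lemma mxtrace_mxunit W (a : 'I_(irr_degree W)) :
  \tr (mxunit a a)
    = #|G|%:R^-1 * \sum_(g in G) \tr (irr_repr W g^-1%g) * \tr (rV g).
Proof.
have tr_const (b : 'I_(irr_degree W)) : \tr (mxunit b b) = \tr (mxunit a a).
  have := mxtrace_mulC (mxunit b a) (mxunit a b).
  by rewrite !mxunitM !eqxx !scale1r.
apply: (mulfI (degree_neq0 W)).
have <- : \sum_(b < irr_degree W) \tr (mxunit b b) = (irr_degree W)%:R * \tr (mxunit a a).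
  by rewrite (eq_bigr (fun=> \tr (mxunit a a))) // sumr_const card_ord mulr_natl.
rewrite mulrA mulr_sumr.
under eq_bigr do rewrite linearZ /= linear_sum /= mulr_sumr.
rewrite exchange_big; apply: eq_bigr => g Gg.
under eq_bigr do rewrite linearZ /= mulrA.
by rewrite -mulr_suml -mulr_sumr mulrA.
Qed.

Lemma mxunit_cent f W (a b : 'I_(irr_degree W)) : centgmx rV f ->
  f *m mxunit a b = mxunit a b *m f.
Proof.
move=> /centgmxP cf; rewrite -scalemxAl -scalemxAr mulmx_sumr mulmx_suml.
congr (_ *: _); apply: eq_bigr => g Gg.
by rewrite -scalemxAr -scalemxAl cf.
Qed.

End MatrixUnits.
End IrreducibleRepresentations.

(** * The commutant of a representation *)

(** With the full-rank factorization E = C R, idempotence reads C (R C) R = C R, and both outer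
    factors cancel. *)
Lemma idempotent_base (F : fieldType) N (E : 'M[F]_N) :
  E *m E = E -> row_base E *m col_base E = 1%:M.
Proof.
move=> idE.
apply: (row_free_inj (row_base_free E)); apply: (row_full_inj (col_base_full E)).
by rewrite mul1mx -mulmxA mulmxA !mulmx_base idE.
Qed.

Lemma mxtrace_idempotent (F : fieldType) N (E : 'M[F]_N) :
  E *m E = E -> \tr E = (\rank E)%:R.
Proof.
move=> idE; rewrite -[X in \tr X](mulmx_base E) mxtrace_mulC.
by rewrite idempotent_base ?mxtrace1.
Qed.

(** The known trace lets the factors have the size m required by the blocks of [matsum], instead of
    the rank of E. *)
Lemma idempotent_split (F : numFieldType) N (E : 'M[F]_N) m :
  E *m E = E -> \tr E = m%:R ->
  exists LR : 'M[F]_(m, N) * 'M[F]_(N, m),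
    LR.1 *m LR.2 = 1%:M /\ LR.2 *m LR.1 = E.
Proof.
move=> idE; rewrite mxtrace_idempotent // => /eqP; rewrite eqr_nat => /eqP <-.
by exists (row_base E, col_base E); rewrite idempotent_base ?mulmx_base.
Qed.

Section CentralizerIso.
Variables (F : numClosedFieldType) (gT : finGroupType) (G : {group gT}).
Variables (N : nat) (rV : mx_representation F G N).
Local Notation irreps := (irreps F G).
Local Notation e V := (@mxunit F gT G N rV V).
Implicit Types W V : irreps.

Definition multiplicity W : F :=
  #|G|%:R^-1 * \sum_(g in G) \tr (irr_repr W g^-1%g) * \tr (rV g).

(** The idempotent e_aa has rank 0, and e_ab = e_aa e_ab. *)
Lemma mxunit0 W (a b : 'I_(irr_degree W)) :
  multiplicity W = 0 -> mxunit rV a b = 0.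
Proof.
rewrite /multiplicity -(mxtrace_mxunit rV a) => tr0.
have idE : mxunit rV a a *m mxunit rV a a = mxunit rV a a.
  by rewrite mxunitM eqxx scale1r.
have [[L R] /= [_ E0]] := idempotent_split idE (tr0 : _ = 0%:R).
rewrite -[mxunit _ _ _]scale1r -[1]/(true%:R) -(eqxx a) -mxunitM -E0.
by rewrite (thinmx0 R) !mul0mx.
Qed.

Lemma matsumDE ds (u v : matsum F ds) i : (u + v) i = u i + v i.
Proof. exact: ffunE. Qed.
Lemma matsumZE ds c (u : matsum F ds) i : (c *: u) i = c *: u i.
Proof. exact: ffunE. Qed.
Lemma matsumME ds (u v : matsum F ds) i : (u * v) i = u i *m v i.
Proof. exact: ffunE. Qed.
Lemma matsum1E ds i : (1 : matsum F ds) i = 1%:M.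
Proof. exact: ffunE. Qed.

Theorem centralizer_iso ds (W : 'I_(size ds) -> irreps) : injective W ->
  (forall i, multiplicity (W i) = (nth 0%N ds i)%:R) ->
  (forall V, V \notin codom W -> multiplicity V = 0) ->
  centralizer_iso_matsum rV ds.
Proof.
move=> injW multW mult0.
pose o V := Ordinal (irr_degree_gt0 V).
have eM V (a b c d : 'I_(irr_degree V)) :
  e V a b *m e V c d = (b == c)%:R *: e V a d by apply: mxunitM.
have eM0 V V' a b c d : V != V' -> e V a b *m e V' c d = 0 by apply: mxunitM0.
(* [L i] and [R i] will identify the multiplicity space of [W i], the image of e_00, with column
   vectors. *)
have [LR LRP] : exists LR : forall i : 'I_(size ds),
      'M_(nth 0%N ds i, N) * 'M_(N, nth 0%N ds i),
    forall i, (LR i).1 *m (LR i).2 = 1%:M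
      /\ (LR i).2 *m (LR i).1 = e _ (o (W i)) (o (W i)).
  apply: (@fin_all_exists 'I_(size ds)
    (fun i => 'M_(nth 0%N ds i, N) * 'M_(N, nth 0%N ds i))%type
    (fun i LR => LR.1 *m LR.2 = 1%:M
      /\ LR.2 *m LR.1 = e _ (o (W i)) (o (W i)))) => i.
  apply: idempotent_split; first by rewrite eM eqxx scale1r.
  by rewrite mxtrace_mxunit -multW.
pose L i := (LR i).1; pose R i := (LR i).2.
have LRK i : L i *m R i = 1%:M by case: (LRP i).
have RLE i : R i *m L i = e _ (o (W i)) (o (W i)) by case: (LRP i).
have LE i : L i *m e _ (o (W i)) (o (W i)) = L i by rewrite -RLE mulmxA LRK mul1mx.
have ER i : e _ (o (W i)) (o (W i)) *m R i = R i by rewrite -RLE -mulmxA LRK mulmx1.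
pose phi (f : centralizer rV) : matsum F ds := [ffun i => L i *m f *m R i].
pose psi0 (u : matsum F ds) : 'M_N :=
  \sum_i \sum_a e (W i) a (o (W i)) *m (R i *m u i *m L i) *m e (W i) (o (W i)) a.
have psi_cent u : centgmx rV (psi0 u).
  apply/centgmxP => h Gh; rewrite mulmx_suml mulmx_sumr.
  apply: eq_bigr => i _; rewrite mulmx_suml mulmx_sumr.
  under eq_bigr do rewrite -(mulmxA _ _ (rV h)) mxunit_mulr // mulmx_sumr.
  under [RHS]eq_bigr do rewrite !mulmxA mxunit_mull // !mulmx_suml.
  rewrite exchange_big; apply: eq_bigr => a _; apply: eq_bigr => b _.
  by rewrite -scalemxAr -!scalemxAl !mulmxA.
exists phi; split.
- move=> c u v; apply/ffunP => i; rewrite matsumDE matsumZE !ffunE.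
  have -> : (c *: u + v : 'M_N) = c *: (u : 'M_N) + (v : 'M_N) by [].
  by rewrite mulmxDr mulmxDl -scalemxAr -scalemxAl.
- split; first by apply/ffunP => i; rewrite matsum1E ffunE mulmx1 LRK.
  move=> u v; apply/ffunP => i; rewrite matsumME !ffunE.
  (* The inserted factor R L = e_00 commutes with v and is then absorbed by R. *)
  transitivity (L i *m (u : 'M_N) *m (R i *m L i) *m (v : 'M_N) *m R i); last first.
    by rewrite !mulmxA.
  rewrite RLE -[in RHS](mulmxA (L i *m _)) -(mxunit_cent _ _ (valP v)).
  rewrite [in RHS]mulmxA -[in RHS](mulmxA _ _ (R i)) ER.
  by rewrite -[in RHS](mulmxA (L i)).
- exists (fun u => Centralizer (psi_cent u)) => [f | u].
    (* Each summand becomes f e_aa. The e_aa of the listed irreducibles already sum to 1, the others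
       being zero. *)
    apply/val_inj; rewrite /= /psi0.
    under eq_bigr => i _.
      under eq_bigr => a _.
        rewrite ffunE.
        have -> : R i *m (L i *m f *m R i) *m L i
            = e _ (o (W i)) (o (W i)) *m f *m e _ (o (W i)) (o (W i)).
          by rewrite -RLE !mulmxA.
        rewrite -(mxunit_cent _ _ (valP f)) !mulmxA -(mxunit_cent _ _ (valP f)).
        rewrite -!mulmxA !(mulmxA (e _ _ _) (e _ _ _)) !eM !eqxx !scale1r.
        over.
      rewrite -mulmx_sumr; over.
    rewrite -mulmx_sumr -[RHS]mulmx1; congr (_ *m _); rewrite -(mxunit_sum1 rV).
    under eq_bigr do under eq_bigr do rewrite mxunitM eqxx scale1r.
    have unW : uniq (codom W) by rewrite map_inj_uniq ?enum_uniq.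
    rewrite [RHS](bigID (mem (codom W))) /= [X in _ = _ + X]big1 ?addr0.
      by rewrite -big_uniq //= big_map big_enum.
    by move=> V /mult0 m0; rewrite big1 // => a _; rewrite mxunit0.
  (* As L j = L j e_00, it kills every e_a0 except the one of [W j] with a = 0. *)
  apply/ffunP => j; rewrite ffunE /= /psi0.
  rewrite mulmx_sumr mulmx_suml (bigD1 j) //= [X in _ + X]big1 ?addr0 => [|i nij].
    rewrite mulmx_sumr mulmx_suml (bigD1 (o (W j))) //=.
    rewrite [X in _ + X]big1 ?addr0 => [|a na].
      by rewrite !mulmxA LE LRK mul1mx -!mulmxA ER LRK mulmx1.
    rewrite -[L j]LE !mulmxA -(mulmxA (L j)) eM eq_sym (negPf na).
    by rewrite scale0r mulmx0 !mul0mx.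
  rewrite mulmx_sumr mulmx_suml big1 // => a _; rewrite -[L j]LE !mulmxA.
  by rewrite -(mulmxA (L j)) eM0 ?mulmx0 ?mul0mx // eq_sym (inj_eq injW).
Qed.
Lemma multiplicity_nat W : exists m, multiplicity W = m%:R.
Proof.
pose a := Ordinal (irr_degree_gt0 W); exists (\rank (e W a a)).
by rewrite -mxtrace_idempotent ?mxunitM ?eqxx ?scale1r // mxtrace_mxunit.
Qed.

(** Irreducibles of multiplicity zero may be listed or dropped; both forms are needed. *)
Theorem centralizer_iso_seq (m : irreps -> nat) (s : seq irreps) :
  (forall V, multiplicity V = (m V)%:R) -> uniq s ->
  (forall V, V \notin s -> m V = 0%N) ->
  centralizer_iso_matsum rV [seq m V | V <- s].
Proof.
move=> multE s_uniq m0.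
have sz := size_map m s.
apply: (@centralizer_iso _ (fun i => tnth (in_tuple s) (cast_ord sz i))).
- have /tuple_uniqP tnth_inj : uniq (in_tuple s) by [].
  by move=> i j /tnth_inj; apply: cast_ord_inj.
- move=> i; have i_lt : (i < size s)%N by rewrite -sz.
  rewrite multE (tnth_nth (tnth (in_tuple s) (cast_ord sz i))) /=.
  by rewrite (nth_map (tnth (in_tuple s) (cast_ord sz i))).
- move=> V sV; rewrite multE m0 //; apply: contra sV => /(nthP V)[i i_lt <-].
  apply/codomP; rewrite -sz in i_lt; exists (Ordinal i_lt).
  by rewrite (tnth_nth V).
Qed.

End CentralizerIso.

(** * Recognizing a character table *)

Section CharacterTable.
Variables (F : numClosedFieldType) (gT : finGroupType) (G : {group gT}).
Variables (r : nat) (d : 'I_r -> nat) (t : 'I_r -> gT -> F).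
Local Notation irreps := (irreps F G).
Implicit Types V : irreps.

Hypothesis tJ : forall i, {in G &, forall g h, t i (g ^ h)%g = t i g}.
Hypothesis t_convol : forall i j, {in G, forall g,
  \sum_(h in G) t i h * t j (g * h^-1)%g = (i == j)%:R * (#|G|%:R / (d i)%:R) * t i g}.
Hypothesis t_col : {in G, forall g,
  \sum_i (d i)%:R * t i g = (g == 1%g)%:R * #|G|%:R}.
Hypothesis d_gt0 : forall i, (0 < d i)%N.
Hypothesis t1 : forall i, t i 1%g = (d i)%:R.
Hypothesis r_ge : (#|classes G| <= r)%N.

(** The action on V of (d_i / |G|) \sum_g t_i(g) g^-1, the expected central idempotent of the i-th
    irreducible. *)
Let z i V : 'M[F]_(irr_degree V) :=
  ((d i)%:R / #|G|%:R) *: \sum_(g in G) t i g *: irr_repr V g^-1%g.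

Let z_scalar i V : {c | z i V = c%:M}.
Proof.
apply: sig_eqW; apply/is_scalar_mxP.
apply: (mx_abs_irr_cent_scalar (group_closure_closed_field (socle_irr V))).
apply/centgmxP => h Gh; rewrite /z -scalemxAl -scalemxAr mulmx_suml mulmx_sumr.
congr (_ *: _); rewrite (reindex_inj (conjg_inj h^-1%g)) /=.
apply: eq_big => [g | g Ggh]; first by rewrite groupJr ?groupV.
have Gg : g \in G by rewrite groupJr ?groupV in Ggh.
rewrite tJ ?groupV // -scalemxAl -scalemxAr -!repr_mxM ?groupV ?groupJ ?groupV //.
by rewrite -conjVg conjgE invgK !mulgA mulgKV.
Qed.

Let c i V := sval (z_scalar i V).
Let cP i V : z i V = (c i V)%:M. Proof. exact: svalP (z_scalar i V). Qed.

Let zM i j V : z i V *m z j V = (i == j)%:R *: z i V.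
Proof.
rewrite /z -scalemxAl -scalemxAr scalerA mulmx_suml.
under eq_bigr => g Gg.
  rewrite -scalemxAl mulmx_sumr scaler_sumr.
  under eq_bigr => h Gh.
    rewrite -scalemxAr -repr_mxM ?groupV // -invMg scalerA.
    over.
  rewrite (reindex_inj (mulIg g^-1%g)) /=.
  under eq_bigl do rewrite groupMr ?groupV //.
  under eq_bigr do rewrite mulgKV.
  over.
rewrite exchange_big /=.
under eq_bigr => h Gh do rewrite -scaler_suml t_convol // -scalerA.
rewrite -scaler_sumr !scalerA; congr (_ *: _).
case: eqP => [->|_]; last by rewrite !mul0r mulr0.
rewrite !mul1r.
have d0 : ((d j)%:R : F) != 0 by rewrite pnatr_eq0 -lt0n d_gt0.
have G0 := natG_neq0 F G.
by field; rewrite d0 G0.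
Qed.

Let sum_c V : \sum_i c i V = 1.
Proof.
have : \sum_i z i V = 1%:M.
  rewrite /z; under eq_bigr do rewrite scaler_sumr.
  rewrite exchange_big (bigD1 1%g) //= [X in _ + X]big1 ?addr0 => [|g /andP[Gg g1]].
    under eq_bigr do rewrite scalerA mulrAC.
    rewrite -scaler_suml -mulr_suml t_col // eqxx mul1r divff ?natG_neq0 //.
    by rewrite scale1r invg1 repr_mx1.
  under eq_bigr do rewrite scalerA mulrAC.
  by rewrite -scaler_suml -mulr_suml t_col // (negPf g1) !mul0r scale0r.
under eq_bigr do rewrite cP.
pose o := Ordinal (irr_degree_gt0 V).
by rewrite -raddf_sum => /(congr1 (fun X : 'M_ _ => X o o)); rewrite !mxE eqxx.
Qed.

Let cM i j V : c i V * c j V = (i == j)%:R * c i V.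
Proof.
have := zM i j V; rewrite !cP -scalar_mxM scale_scalar_mx.
pose o := Ordinal (irr_degree_gt0 V).
by move=> /(congr1 (fun X : 'M_ _ => X o o)); rewrite !mxE eqxx.
Qed.

(** Convolving t_i with the regular character multiplies it by |G|; decomposing that character makes
    [z i V] appear. *)
Let t_expand i g : g \in G ->
  (d i)%:R * t i g = \sum_(V : irreps) (irr_degree V)%:R * c i V * \tr (irr_repr V g).
Proof.
move=> Gg.
have G0 := natG_neq0 F G.
apply: (mulIf G0).
transitivity ((d i)%:R * \sum_(h in G) t i h *
    \sum_(V : irreps) (irr_degree V)%:R * \tr (irr_repr V (g * h^-1)%g)).
  rewrite (bigD1 g) //= [X in _ + X]big1 ?addr0 => [|h /andP[Gh nhg]].
    by rewrite sum_degree_trace ?groupM ?groupV // mulgV eqxx mul1r mulrA.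
  rewrite sum_degree_trace ?groupM ?groupV // -eq_mulgV1 eq_sym (negPf nhg).
  by rewrite mul0r mulr0.
under eq_bigr do rewrite mulr_sumr.
rewrite exchange_big mulr_sumr mulr_suml /=; apply: eq_bigr => V _.
rewrite -[in RHS]mulrA.
have -> : c i V * \tr (irr_repr V g) = \tr (irr_repr V g *m z i V).
  by rewrite cP mul_mx_scalar linearZ.
rewrite /z -scalemxAr linearZ mulmx_sumr linear_sum /= !mulr_sumr mulr_suml.
apply: eq_bigr => h Gh.
rewrite -scalemxAr linearZ -repr_mxM ?groupV //=.
by field.
Qed.

(** For each V the scalars [c i V] are orthogonal idempotents of a field with sum 1, so exactly one
    of them is 1, at an index tau V. Then d_i t_i is the sum of deg(V) chi_V over the fibre of tau
    at i. It is nonzero at 1, so tau is onto, hence bijective because r is at least the number of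
    irreducibles. The value at 1 gives d_i = deg(V). *)
Theorem character_table_irreducible : exists W : 'I_r -> irreps,
  bijective W /\ forall i, {in G, forall g, \tr (irr_repr (W i) g) = t i g}.
Proof.
have [tau tauP] : exists tau : irreps -> 'I_r, forall V, c (tau V) V = 1.
  apply: (@fin_all_exists {: irreps} (fun=> 'I_r) (fun V i => c i V = 1)) => V.
  have [i ci] : exists i, c i V != 0.
    apply/existsP; apply: contraTT isT => /existsPn c0.
    have := sum_c V; rewrite big1 => [/eqP|i _]; first by rewrite eq_sym oner_eq0.
    by apply/eqP; move: (c0 i); rewrite negbK.
  by exists i; apply: (mulfI ci); rewrite cM eqxx mulrC.
have cE i V : c i V = (i == tau V)%:R.
  rewrite -[c i V]mulr1 -(tauP V) cM.
  by case: eqP => [->|_]; rewrite ?tauP ?mulr1 // mul0r.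
have dE i g : g \in G -> (d i)%:R * t i g
    = \sum_(V | i == tau V) (irr_degree V)%:R * \tr (irr_repr V g).
  move=> Gg; rewrite t_expand // [RHS]big_mkcond; apply: eq_bigr => V _.
  by rewrite cE; case: eqP => _; rewrite ?mulr1 // mulr0 mul0r.
have [W WK] : exists W : 'I_r -> irreps, cancel W tau.
  apply: (@fin_all_exists 'I_r (fun=> irreps) (fun i V => tau V = i)) => i.
  have [V /eqP iV|none] := pickP (fun V => i == tau V); first by exists V.
  have /eqP := dE i 1%g (group1 G); rewrite t1 big_pred0 // mulf_eq0 !pnatr_eq0.
  by rewrite orbb eqn0Ngt d_gt0.
have bijW : bijective W.
  by apply: inj_card_bij (can_inj WK) _; rewrite irreps_count card_ord.
have tauK : cancel tau W by apply/(bij_can_sym bijW).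
exists W; split=> // i g Gg.
have {}dE h : h \in G -> (d i)%:R * t i h
    = (irr_degree (W i))%:R * \tr (irr_repr (W i) h).
  move=> Gh; rewrite dE // (big_pred1 (W i)) // => V.
  by rewrite /= -(can_eq tauK) WK.
have eq_deg : (irr_degree (W i))%:R = (d i)%:R :> F.
  have /eqP := dE 1%g (group1 G).
  rewrite t1 repr_mx1 mxtrace1 -!natrM eqr_nat !mulnn eqn_exp2r // => /eqP.
  by move->.
have := dE g Gg; rewrite eq_deg => /mulfI -> //.
by rewrite pnatr_eq0 -lt0n.
Qed.

End CharacterTable.

(** * Permutation groups given by lists *)

Local Open Scope nat_scope.

Section PermutationCodes.

(** [p] is applied first, as in the product of ['S_n]. *)
Definition pcomp (p q : seq nat) := [seq nth 0 q i | i <- p].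
Definition pinv (p : seq nat) := [seq index i p | i <- iota 0 (size p)].
Definition pfix (p : seq nat) := count (fun i => nth 0 p i == i) (iota 0 (size p)).

Variable n : nat.

Definition code (s : 'S_n) : seq nat := [seq val (s x) | x <- enum 'I_n].

Lemma size_code s : size (code s) = n.
Proof. by rewrite size_map size_enum_ord. Qed.

Lemma nth_code s (x : 'I_n) : nth 0 (code s) x = s x.
Proof. by rewrite (nth_map x) ?size_enum_ord ?nth_ord_enum. Qed.

Lemma code_inj : injective code.
Proof.
move=> s t est; apply/permP => x; apply: val_inj.
by rewrite /= -!nth_code est.
Qed.

Lemma code1 : code 1 = iota 0 n.
Proof. by rewrite -val_enum_ord; apply: eq_map => x; rewrite perm1. Qed.

Lemma codeM s t : code (s * t) = pcomp (code s) (code t).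
Proof. by rewrite /pcomp -map_comp; apply: eq_map => x; rewrite /= nth_code permM. Qed.

Lemma codeV s : code s^-1 = pinv (code s).
Proof.
rewrite /pinv size_code -val_enum_ord -map_comp; apply: eq_map => x /=.
have /(congr1 val) /= <- : s (s^-1%g x) = x := permKV s x.
rewrite -(nth_code s) index_uniq ?size_code //.
by rewrite map_inj_uniq ?enum_uniq // => y z /val_inj/perm_inj.
Qed.

Lemma pfix_code s : pfix (code s) = #|[pred x | s x == x]|.
Proof.
rewrite /pfix size_code -val_enum_ord count_map cardE size_filter -enumT.
by apply: eq_count => x; rewrite /= nth_code.
Qed.

End PermutationCodes.

Section GeneratedGroup.
Variables (n : nat) (A : {set 'S_n}) (gs : seq (seq nat)).
Hypothesis codeA : [seq code s | s in A] =i gs.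

Definition word (w : seq nat) : seq nat :=
  foldr (fun i p => pcomp (nth [::] gs i) p) (iota 0 n) w.

Definition power_list (w : seq nat) m :=
  [seq iter j (pcomp (word w)) (iota 0 n) | j <- iota 0 m].

(* [:: (w_1, m_1); ...; (w_s, m_s)] stands for the list of the products         *)
(* w_1^i_1 ... w_s^i_s with 0 <= i_j < m_j.                                     *)
Definition product_list (fs : seq (seq nat * nat)) : seq (seq nat) :=
  foldr (fun f l => [seq pcomp p q | p <- power_list f.1 f.2, q <- l])
    [:: iota 0 n] fs.

Let in_gen p := exists2 s, s \in <<A>>%g & code s = p.

Let in_gen1 : in_gen (iota 0 n).
Proof. by exists 1%g; rewrite ?group1 ?code1. Qed.

Let in_genM p q : in_gen p -> in_gen q -> in_gen (pcomp p q).
Proof. by move=> [s As <-] [t At <-]; exists (s * t)%g; rewrite ?groupM ?codeM. Qed.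

Lemma word_gen w : all (gtn (size gs)) w -> in_gen (word w).
Proof.
elim: w => [|i w IHw] //= /andP[i_lt /IHw]; apply: in_genM.
have /imageP[s As ->] : nth [::] gs i \in [seq code s | s in A].
  by rewrite codeA mem_nth.
by exists s => //; apply: mem_gen.
Qed.

Lemma product_list_gen fs p : all (fun f => all (gtn (size gs)) f.1) fs ->
  p \in product_list fs -> in_gen p.
Proof.
elim: fs p => [|[w m] fs IHfs] p /=; first by rewrite inE => _ /eqP->.
case/andP => w_ok /IHfs{}IHfs /allpairsP[[a b] /= [/mapP[j _ ->] /IHfs b_ok ->]].
apply: in_genM => //; elim: j => [|j IHj] //=; apply: in_genM => //.
exact: word_gen.
Qed.

Variable L : seq (seq nat).
Hypothesis L_gen : forall p, p \in L -> in_gen p.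
Hypothesis L_uniq : uniq L.
Hypothesis L1 : iota 0 n \in L.
Hypothesis L_closed : {in gs, forall c, {subset [seq pcomp p c | p <- L] <= L}}.

(** In a finite group the generated subgroup consists of products of generators without inverses, so
    closure under right multiplication by generators suffices. *)
Lemma mem_code_gen s : (code s \in L) = (s \in <<A>>%g).
Proof.
apply/idP/idP => [/L_gen[t At /code_inj <-]|] //.
case/gen_prodgP => m [c Ac ->]; elim: m c Ac => [|m IHm] c Ac.
  by rewrite big_ord0 code1.
rewrite big_ord_recr codeM /=.
have cgs : code (c ord_max) \in gs by rewrite -codeA image_f ?Ac.
have closed_c := L_closed cgs.
by apply/closed_c/map_f/IHm => i; apply: Ac.
Qed.

Lemma perm_code_gen : perm_eq [seq code s | s in <<A>>%g] L.
Proof.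
apply: uniq_perm => //; first by rewrite map_inj_uniq ?enum_uniq //; apply: code_inj.
move=> p; apply/imageP/idP => [[s As ->]|/L_gen[s As <-]].
  by rewrite mem_code_gen.
by exists s.
Qed.

End GeneratedGroup.

Section NatCycles.
Variable n : nat.

Definition nat_cyc (c : seq nat) : seq nat :=
  [seq next [seq i.-1 | i <- c] x | x <- iota 0 n.+1].

Definition nat_cycles (cs : seq (seq nat)) : seq nat :=
  foldr (fun c => pcomp (nat_cyc c)) (iota 0 n.+1) cs.

Definition is_cyc (c : seq nat) :=
  all (fun i => i.-1 <= n) c && uniq [seq i.-1 | i <- c].

Lemma code_cyc c : is_cyc c -> code (cyc c : 'S_n.+1) = nat_cyc c.
Proof.
case/andP => c_le c_uniq.
have val_c : [seq val i | i <- [seq (inord i.-1 : 'I_n.+1) | i <- c]]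
    = [seq i.-1 | i <- c].
  rewrite -map_comp; apply/eq_in_map => i ic.
  by rewrite /= inordK // ltnS (allP c_le).
rewrite /nat_cyc -val_enum_ord -map_comp; apply: eq_map => x /=.
have c_uniq' : uniq [seq (inord i.-1 : 'I_n.+1) | i <- c].
  by rewrite -(map_inj_uniq val_inj) val_c.
by rewrite cycE // -val_c (next_map val_inj).
Qed.

Lemma code_cycles cs : all is_cyc cs -> code (cycles cs : 'S_n.+1) = nat_cycles cs.
Proof.
rewrite /cycles; elim: cs => [|c cs IHcs] /=; first by rewrite big_nil code1.
by case/andP => /code_cyc c_ok /IHcs cs_ok; rewrite big_cons codeM c_ok cs_ok.
Qed.

Lemma code_cycles_set (A : {set 'S_n.+1}) css :
  all (all is_cyc) css -> A =i [seq cycles cs | cs <- css] ->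
  [seq code s | s in A] =i [seq nat_cycles cs | cs <- css].
Proof.
move=> css_ok defA p; apply/imageP/mapP => [[s]|[cs cs_in ->]].
  rewrite defA => /mapP[cs cs_in ->] ->.
  by exists cs; rewrite ?code_cycles ?(allP css_ok).
exists (cycles cs); last by rewrite code_cycles ?(allP css_ok).
by rewrite defA map_f.
Qed.

End NatCycles.

(** * Verification of the character table of a permutation group *)

(* A trie maps a permutation code to the index of its conjugacy class. Nothing  *)
(* is proved about class_trie: data_check validates the map that it defines.    *)
Inductive trie := Leaf of nat | Node of seq trie.

Fixpoint trie_insert (p : seq nat) (c : nat) (t : trie) : trie :=
  if p is x :: p' then
    let s := if t is Node s then s else [::] in
    Node (set_nth (Leaf 0) s x (trie_insert p' c (nth (Leaf 0) s x)))
  else Leaf c.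

Fixpoint trie_find (t : trie) (p : seq nat) : nat :=
  match t, p with
  | Leaf c, _ => c
  | Node s, x :: p' => trie_find (nth (Leaf 0) s x) p'
  | Node _, [::] => 0
  end.

Definition conjugates (L : seq (seq nat)) (r : seq nat) :=
  [seq pcomp (pcomp (pinv p) r) p | p <- L].

(* The first b points are a base: they determine the permutation. *)
Definition class_trie b L (reps : seq (seq nat)) : trie :=
  foldr (fun kr t => foldr (fun p => trie_insert (take b p) kr.1) t (conjugates L kr.2))
    (Leaf 0) (zip (iota 0 (size reps)) reps).

(* The pair (x, y) stands for x + y alpha, where alpha^2 = - alpha - 2. *)
Definition qint := (Z * Z)%type.
Definition qzero : qint := (Z0, Z0).
Definition qadd (x y : qint) : qint := (Z.add x.1 y.1, Z.add x.2 y.2).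
Definition qmul (x y : qint) : qint :=
  let xy2 := Z.mul x.2 y.2 in
  (Z.sub (Z.mul x.1 y.1) (Z.double xy2),
   Z.sub (Z.add (Z.mul x.1 y.2) (Z.mul x.2 y.1)) xy2).
Definition qscale (m : nat) (x : qint) : qint :=
  (Z.mul (Z.of_nat m) x.1, Z.mul (Z.of_nat m) x.2).
Definition qeq (x y : qint) : bool := (Z.eqb x.1 y.1 && Z.eqb x.2 y.2).
Definition qsum (s : seq qint) : qint := foldr qadd qzero s.
Definition qdot (s t : seq qint) : qint := qsum [seq qmul p.1 p.2 | p <- zip s t].
Definition qcomb (v : seq nat) (s : seq qint) : qint :=
  qsum [seq qscale p.1 p.2 | p <- zip v s].

Definition tally r (s : seq nat) : seq nat :=
  foldr (fun m v => incr_nth v m) (nseq r 0) s.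

(** * Evaluation of Z[alpha] in the field *)

Section QuadraticEvaluation.
Local Open Scope ring_scope.
Variables (F : numClosedFieldType).

(** The value of a character of degree 3 at an element of order 7. *)
Definition alpha : F := (sqrtC (- 7%:R) - 1) / 2%:R.

Lemma alpha2 : alpha ^+ 2 = - alpha - 2%:R.
Proof.
have := sqrtCK (- 7%:R : F); rewrite /alpha; move: (sqrtC _) => s s2.
have -> : ((s - 1) / 2%:R) ^+ 2 = (s ^+ 2 - 2%:R * s + 1) / 4%:R by field.
by rewrite s2; field.
Qed.

Definition intZ (z : Z) : F := (int_of_Z z)%:~R.

Lemma intZD x y : intZ (Z.add x y) = intZ x + intZ y.
Proof. by rewrite /intZ -intrD -[in RHS]rmorphD. Qed.
Lemma intZM x y : intZ (Z.mul x y) = intZ x * intZ y.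
Proof. by rewrite /intZ -intrM -[in RHS]rmorphM. Qed.
Lemma intZB x y : intZ (Z.sub x y) = intZ x - intZ y.
Proof. by rewrite /intZ -intrB -[in RHS]rmorphB. Qed.
Lemma intZ_double x : intZ (Z.double x) = 2%:R * intZ x.
Proof. by rewrite Z.double_spec intZM. Qed.
Lemma intZ_nat m : intZ (Z.of_nat m) = m%:R.
Proof. by rewrite /intZ; case: m => //= m; rewrite SuccNat2Pos.id_succ. Qed.

Definition qev (x : qint) : F := intZ x.1 + intZ x.2 * alpha.

Lemma qev_int z : qev (z, Z0) = intZ z.
Proof. by rewrite /qev /intZ /= mul0r addr0. Qed.
Lemma intZ_of_int (m : int) : intZ (Z_of_int m) = m%:~R.
Proof. by rewrite /intZ Z_of_intK. Qed.

Lemma qevD x y : qev (qadd x y) = qev x + qev y.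
Proof. by rewrite /qev /= !intZD; ring. Qed.
Lemma qevM x y : qev (qmul x y) = qev x * qev y.
Proof.
rewrite /qev /= !(intZD, intZM, intZB, intZ_double).
by have := alpha2; set a := alpha => a2; ring: a2.
Qed.
Lemma qev_scale m x : qev (qscale m x) = m%:R * qev x.
Proof. by rewrite /qev /= !intZM !intZ_nat; ring. Qed.
Lemma qev_eq x y : qeq x y -> qev x = qev y.
Proof.
by case: x y => [a b] [c d] /andP[/Z.eqb_eq /= -> /Z.eqb_eq /= ->].
Qed.
Lemma qev_sum s : qev (qsum s) = \sum_(x <- s) qev x.
Proof.
elim: s => [|x s IHs]; first by rewrite big_nil /qev /intZ /= mul0r addr0.
by rewrite big_cons -IHs -qevD.
Qed.

Lemma qev_dot r s t : size s = r -> size t = r ->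
  qev (qdot s t) = \sum_(a < r) qev (nth qzero s a) * qev (nth qzero t a).
Proof.
move=> sz_s sz_t; rewrite qev_sum big_map (big_nth (qzero, qzero)).
rewrite size_zip sz_s sz_t minnn big_mkord; apply: eq_bigr => a _.
by rewrite nth_zip ?sz_s ?sz_t // qevM.
Qed.

Lemma qev_comb r v s : size v = r -> size s = r ->
  qev (qcomb v s) = \sum_(a < r) (nth 0%N v a)%:R * qev (nth qzero s a).
Proof.
move=> sz_s sz_t; rewrite qev_sum big_map (big_nth (0%N, qzero)).
rewrite size_zip sz_s sz_t minnn big_mkord; apply: eq_bigr => a _.
by rewrite nth_zip ?sz_s ?sz_t // qev_scale.
Qed.

Lemma size_tally r s : all (gtn r) s -> size (tally r s) = r.
Proof.
elim: s => [|m s IHs] /=; first by rewrite size_nseq.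
by case/andP => m_lt /IHs sz; rewrite size_incr_nth sz m_lt.
Qed.

Lemma tally_sum r s (f : nat -> F) : all (gtn r) s ->
  \sum_(m <- s) f m = \sum_(a < r) (nth 0%N (tally r s) a)%:R * f a.
Proof.
elim: s => [|m s IHs] /=.
  by rewrite big_nil big1 // => a _; rewrite nth_nseq ltn_ord mul0r.
case/andP => m_lt /IHs {}IHs; rewrite big_cons IHs.
under [RHS]eq_bigr do rewrite nth_incr_nth natrD mulrDl.
rewrite big_split /=; congr (_ + _).
rewrite (bigD1 (Ordinal m_lt)) //= eqxx mul1r big1 ?addr0 // => a.
by rewrite -val_eqE eq_sym => /negPf /= ->; rewrite mul0r.
Qed.

End QuadraticEvaluation.

Section TableData.
Variables (n r : nat) (L gs reps : seq (seq nat)) (cls : seq nat -> nat).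
Variables (T : seq (seq qint)) (ds : seq nat).

Definition class_function_check : bool :=
  all (fun p => (cls p < r) && ((cls p == 0) == (p == iota 0 n))) L &&
  all (fun c => all (fun p => cls (pcomp p c) == cls (pcomp c p)) L) gs.

(* The two factors in the last clause are the order of the centralizer of the   *)
(* representative and the size of its fibre, so that this fibre is one class.   *)
Definition representatives_check : bool :=
  (size reps == r) &&
  all (fun kp => [&& kp.2 \in L, cls kp.2 == kp.1 &
    count (fun p => pcomp p kp.2 == pcomp kp.2 p) L *
      count (fun p => cls p == kp.1) L == size L]) (zip (iota 0 r) reps).

Definition shape_check : bool :=
  [&& size T == r, size ds == r, all (fun row => size row == r) T, all (ltn 0) ds &
    all (fun rd => qeq (nth qzero rd.1 0) (Z.of_nat rd.2, Z0)) (zip T ds)].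

Definition column_check : bool :=
  all (fun k => qeq (qcomb ds [seq nth qzero row k | row <- T])
                    (qscale ((k == 0) * size L) (Z.of_nat 1, Z0)))
      (iota 0 r).

(* For a representative g, M lists for each class a the multiplicities of the   *)
(* classes in g C_a^-1, and D the sums of a row of T with these multiplicities. *)
Definition convolution_check : bool :=
  let inv_classes := [seq [seq pinv p | p <- L & cls p == a] | a <- iota 0 r] in
  all (fun kp =>
    let M := [seq tally r [seq cls (pcomp kp.2 q) | q <- C] | C <- inv_classes] in
    all (fun jt =>
      let D := [seq qcomb v jt.2 | v <- M] in
      all (fun its => qeq (qscale its.2.2 (qdot its.2.1 D))
               (qscale ((its.1 == jt.1) * size L) (nth qzero its.2.1 kp.1)))
        (zip (iota 0 r) (zip T ds)))
      (zip (iota 0 r) T))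
    (zip (iota 0 r) reps).

End TableData.

Lemma all_zip_iota (T1 : Type) (x0 : T1) r (s : seq T1) (a : pred (nat * T1)) :
  size s = r -> all a (zip (iota 0 r) s) -> forall k, k < r -> a (k, nth x0 s k).
Proof.
move=> sz_s /(all_nthP (0, x0)) ok k k_lt.
have := ok k; rewrite size_zip size_iota sz_s minnn => /(_ k_lt).
by rewrite nth_zip ?size_iota // nth_iota.
Qed.

(** The t with f (s t) = f (t s) for all s form a subgroup, so generators are enough. *)
Lemma gen_class_function (gT : finGroupType) (A : {set gT}) (V : eqType) (f : gT -> V) :
    (forall a s : gT, a \in A -> s \in <<A>>%g -> f (s * a)%g = f (a * s)%g) ->
  forall s t : gT, s \in <<A>>%g -> t \in <<A>>%g -> f (s ^ t)%g = f s.
Proof.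
move=> fA.
pose H := [set t in <<A>>%g | [forall s in <<A>>%g, f (s * t)%g == f (t * s)%g]].
have gH : group_set H.
  apply/group_setP; split=> [|t u].
    by rewrite inE group1; apply/forall_inP => s _; rewrite mulg1 mul1g.
  rewrite !inE => /andP[Gt /forall_inP ft] /andP[Gu /forall_inP fu].
  rewrite groupM //; apply/forall_inP => s Gs.
  by rewrite mulgA (eqP (fu _ _)) ?groupM // mulgA (eqP (ft _ _)) ?groupM // mulgA.
have /subsetP sGH : <<A>>%g \subset Group gH.
  rewrite gen_subG; apply/subsetP => a Aa; rewrite inE mem_gen //.
  by apply/forall_inP => s Gs; rewrite fA.
have comm s t : s \in <<A>>%g -> t \in <<A>>%g -> f (s * t)%g = f (t * s)%g.
  by move=> Gs /sGH; rewrite inE => /andP[_ /forall_inP /(_ s Gs)/eqP].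
move=> s t Gs Gt; rewrite conjgE comm ?groupV ?groupM //.
by rewrite mulgK.
Qed.

Section TableCharacters.
Local Open Scope ring_scope.
Variables (F : numClosedFieldType) (n r : nat) (G : {group 'S_n}).
Variables (A : {set 'S_n}) (L gs reps : seq (seq nat)) (cls : seq nat -> nat).
Variables (T : seq (seq qint)) (ds : seq nat).
Local Open Scope nat_scope.

Hypothesis genG : G = <<A>>%G.
Hypothesis codeA : [seq code s | s in A] =i gs.
Hypothesis permL : perm_eq [seq code s | s in G] L.
Hypothesis cls_ok : class_function_check n r L gs cls.
Hypothesis reps_ok : representatives_check r L reps cls.
Hypothesis shape_ok : shape_check r T ds.
Hypothesis col_ok : column_check r L T ds.
Hypothesis conv_ok : convolution_check r L reps cls T ds.

Definition table_char (i : 'I_r) (s : 'S_n) : F :=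
  qev F (nth qzero (nth [::] T i) (cls (code s))).

Let codeG s : (code s \in L) = (s \in G).
Proof.
rewrite -(perm_mem permL); apply/imageP/idP => [[t Gt /code_inj ->]|Gs] //.
by exists s.
Qed.

Let sum_code (f : seq nat -> F) : (\sum_(s in G) f (code s) = \sum_(p <- L) f p)%R.
Proof. by rewrite -(perm_big _ permL) big_map big_enum. Qed.

Let count_code (P : pred (seq nat)) : count P L = #|[set s in G | P (code s)]|.
Proof.
rewrite -(seq.permP permL) count_map -sum1dep_card -big_enum_cond.
by rewrite sum1_count; apply: eq_count.
Qed.

Let cardG : #|G| = size L.
Proof.
rewrite -(perm_size permL) size_map -cardE; exact: eq_card.
Qed.

Let cls_lt s : s \in G -> cls (code s) < r.
Proof. by rewrite -codeG => Ls; case/andP: cls_ok => /allP/(_ _ Ls)/andP[]. Qed.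

Let cls0 s : s \in G -> (cls (code s) == 0) = (s == 1%g).
Proof.
rewrite -codeG => Ls; case/andP: cls_ok => /allP/(_ _ Ls)/andP[_ /eqP ->] _.
by rewrite -(code1 n) (inj_eq (@code_inj n)).
Qed.

Let clsJ : {in G &, forall s t, cls (code (s ^ t)) = cls (code s)}.
Proof.
have commA t : t \in A -> {in G, forall s, cls (code (s * t)) = cls (code (t * s))}.
  move=> At s; rewrite -codeG !codeM => Ls.
  have gs_t : code t \in gs by rewrite -codeA image_f.
  by case/andP: cls_ok => _ /allP/(_ _ gs_t)/allP/(_ _ Ls)/eqP.
move=> s t; rewrite genG => Gs Gt.
apply: (gen_class_function (f := cls \o @code n)) Gs Gt => a u Aa Gu.
by apply: commA; rewrite ?genG.
Qed.

Let rep_ex (k : 'I_r) : exists2 s, s \in G &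
  [/\ code s = nth [::] reps k, cls (code s) = k &
      forall t, t \in G -> cls (code t) = k -> t \in (s ^: G)%g].
Proof.
case/andP: reps_ok => /eqP sz /(all_zip_iota [::] sz)/(_ k (ltn_ord k)).
case/and3P => /= ; rewrite -(perm_mem permL) => /imageP[s Gs es].
rewrite es => /eqP ck /eqP count_s; exists s => //; split=> //.
have clsS : (s ^: G)%g \subset [set t in G | cls (code t) == k].
  apply/subsetP => t /imsetP[u Gu ->].
  by rewrite inE groupJ // clsJ // ck eqxx.
(* The class lies in the fibre; by orbit-stabilizer and the checked product of sizes, the fibre
   cannot be larger. *)
move=> t Gt ct; have /eqP -> : (s ^: G)%g == [set t in G | cls (code t) == k].
  rewrite eqEcard clsS /= -(count_code (fun p => cls p == k)).
  rewrite -(leq_pmul2l (cardG_gt0 'C_G[s]%G)) -index_cent1 Lagrange ?subsetIl //.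
  rewrite cardG -count_s leq_mul2r; apply/orP; right.
  rewrite count_code; apply: subset_leq_card; apply/subsetP => u.
  by move=> /setIP[Gu /cent1P us]; rewrite inE Gu -!codeM us eqxx.
by rewrite inE Gt ct eqxx.
Qed.

Let card_classes : #|classes G| <= r.
Proof.
have [rep Grep repP] := fin_all_exists2 rep_ex.
rewrite -[r]card_ord -cardsT.
apply: leq_trans (leq_imset_card (fun k => (rep k ^: G)%g) _).
apply: subset_leq_card; apply/subsetP => _ /imsetP[t Gt ->].
apply/imsetP; exists (Ordinal (cls_lt Gt)) => //; apply/class_eqP.
by have [_ _] := repP (Ordinal (cls_lt Gt)); apply.
Qed.

Let size_T : size T = r. Proof. by case/and5P: shape_ok => /eqP. Qed.
Let size_ds : size ds = r. Proof. by case/and5P: shape_ok => _ /eqP. Qed.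
Let size_row (i : 'I_r) : size (nth [::] T i) = r.
Proof.
by case/and5P: shape_ok => _ _ /allP row_T _ _; apply/eqP/row_T; rewrite mem_nth ?size_T.
Qed.

Local Open Scope ring_scope.

Lemma table_char_conj i : {in G &, forall s t, table_char i (s ^ t)%g = table_char i s}.
Proof. by move=> s t Gs Gt; rewrite /table_char clsJ. Qed.

Lemma table_char_convolution i j : {in G, forall s,
  \sum_(t in G) table_char i t * table_char j (s * t^-1)%g
    = (i == j)%:R * (#|G|%:R / (nth 0%N ds i)%:R) * table_char i s}.
Proof.
move=> s Gs; set k := Ordinal (cls_lt Gs).
have [u Gu [code_u cls_u /(_ s Gs erefl)/imsetP[v Gv es]]] := rep_ex k.
(* Both sides are class functions of s, which may thus be replaced by its representative u. *)
transitivity (\sum_(t in G) table_char i t * table_char j (u * t^-1)%g).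
  rewrite es (reindex_inj (conjg_inj v)) /=.
  apply: eq_big => [t|t Gt]; first by rewrite groupJr.
  have {}Gt : t \in G by rewrite groupJr in Gt.
  by rewrite -conjVg -conjMg !table_char_conj ?groupM ?groupV.
have -> : table_char i s = table_char i u by rewrite es table_char_conj.
move: k code_u cls_u => {s Gs es v Gv} k code_u cls_u.
pose Li a := [seq pinv p | p <- L & cls p == a].
pose v a := tally r [seq cls (pcomp (code u) q) | q <- Li a].
have cls_prod a : all (gtn r) [seq cls (pcomp (code u) q) | q <- Li a].
  apply/allP => _ /mapP[_ /mapP[p + ->] ->]; rewrite mem_filter => /andP[_].
  rewrite -(perm_mem permL) => /imageP[t Gt ->].
  by rewrite -codeV -codeM /= cls_lt ?groupM ?groupV.
have -> : \sum_(t in G) table_char i t * table_char j (u * t^-1)%g =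
    \sum_(a < r) qev F (nth qzero (nth [::] T i) a) * qev F (qcomb (v a) (nth [::] T j)).
  under eq_bigr do rewrite /table_char codeM codeV.
  pose f p := qev F (nth qzero (nth [::] T i) (cls p)) *
    qev F (nth qzero (nth [::] T j) (cls (pcomp (code u) (pinv p)))).
  rewrite (sum_code f).
  (* The sum is split by the class a of t; [v a] tallies the classes of the products u t^-1. *)
  rewrite (eq_big_seq (fun p => \sum_(a < r) if cls p == a then f p else 0)).
    rewrite exchange_big /=; apply: eq_bigr => a _; rewrite -big_mkcond /=.
    under eq_bigr => p /eqP cp do rewrite /f cp.
    rewrite -mulr_sumr (@qev_comb _ r) ?size_row ?size_tally //.
    rewrite -(tally_sum (fun m => qev F (nth qzero (nth [::] T j) m))) //.
    by rewrite !big_map big_filter.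
  move=> p; rewrite -(perm_mem permL) => /imageP[t /cls_lt t_lt ->].
  rewrite (bigD1 (Ordinal t_lt)) //= eqxx big1 ?addr0 // => a.
  by rewrite -val_eqE eq_sym => /negPf /= ->.
have d0 : (nth 0%N ds i)%:R != 0 :> F.
  rewrite pnatr_eq0 -lt0n; case/and5P: shape_ok => _ _ _ /allP ds_gt0 _.
  by apply: ds_gt0; rewrite mem_nth ?size_ds.
(* The check avoids division: it is the identity multiplied by d_i. *)
apply: (mulfI d0).
have size_reps : size reps = r by case/andP: reps_ok => /eqP.
have /(all_zip_iota [::] size_T)/(_ j (ltn_ord j)) /= :=
  all_zip_iota [::] size_reps conv_ok (ltn_ord k).
have size_Tds : size (zip T ds) = r by rewrite size_zip size_T size_ds minnn.
move/(all_zip_iota ([::], 0%N) size_Tds)/(_ i (ltn_ord i)) => /=.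
rewrite nth_zip ?size_T ?size_ds //= => /(qev_eq F).
rewrite !qev_scale (@qev_dot _ r) ?size_row ?size_map ?size_iota // => e.
set D := [seq qcomb _ _ | _ <- _] in e.
transitivity ((nth 0%N ds i)%:R *
    \sum_(a < r) qev F (nth qzero (nth [::] T i) a) * qev F (nth qzero D a)).
  congr (_ * _); apply: eq_bigr => a _; congr (_ * _).
  rewrite (nth_map [::]) ?size_map ?size_iota // (nth_map [::]) ?size_map ?size_iota //.
  by rewrite (nth_map 0%N) ?size_iota // nth_iota // -code_u.
rewrite e natrM /table_char cls_u cardG -(val_eqE i j) /=.
by field.
Qed.

Lemma table_char_column : {in G, forall s,
  \sum_(i < r) (nth 0%N ds i)%:R * table_char i s = (s == 1%g)%:R * #|G|%:R}.
Proof.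
move=> s Gs; have k_in : cls (code s) \in iota 0 r by rewrite mem_iota cls_lt.
have := qev_eq F (allP col_ok _ k_in).
rewrite (@qev_comb _ r) ?size_map // qev_scale => e.
transitivity (\sum_(i < r) (nth 0%N ds i)%:R *
  qev F (nth qzero [seq nth qzero row (cls (code s)) | row <- T] i)).
  by apply: eq_bigr => i _; rewrite (nth_map [::]) ?size_T.
by rewrite e cls0 // -cardG natrM qev_int mulr1.
Qed.

Lemma table_char1 i : table_char i 1%g = (nth 0%N ds i)%:R.
Proof.
rewrite /table_char; have := cls0 (group1 G); rewrite eqxx => /eqP ->.
case/and5P: shape_ok => _ _ _ _ /allP ok.
have /ok/(qev_eq F) /= : nth ([::], 0%N) (zip T ds) i \in zip T ds.
  by rewrite mem_nth // size_zip size_T size_ds minnn.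
rewrite nth_zip ?size_T ?size_ds //= => ->.
by rewrite qev_int intZ_nat.
Qed.

Theorem table_char_irreducible : exists W : 'I_r -> irreps F G,
  bijective W /\ forall i, {in G, forall s, \tr (irr_repr (W i) s) = table_char i s}.
Proof.
apply: (character_table_irreducible (d := fun i : 'I_r => nth 0%N ds i)).
- exact: table_char_conj.
- exact: table_char_convolution.
- exact: table_char_column.
- move=> i; case/and5P: shape_ok => _ _ _ /allP ds_gt0 _.
  by apply: ds_gt0; rewrite mem_nth ?size_ds.
- exact: table_char1.
- exact: card_classes.
Qed.

End TableCharacters.

(** * Certifying the list of group elements *)

Fixpoint lexlt (p q : seq nat) : bool :=
  match p, q with
  | x :: p', y :: q' => (x < y) || (x == y) && lexlt p' q'
  | [::], _ :: _ => true
  | _, [::] => false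
  end.

Lemma lexlt_irr : irreflexive lexlt.
Proof. by elim=> [|x p IHp] //=; rewrite ltnn eqxx IHp. Qed.

Lemma lexlt_trans : transitive lexlt.
Proof.
elim=> [|y q IHq] [|x p] [|z s] //=.
case/orP => [xy|/andP[/eqP-> pq]] /orP[yz|/andP[/eqP<- qs]].
- by rewrite (ltn_trans xy yz).
- by rewrite xy.
- by rewrite yz.
- by rewrite eqxx (IHq _ _ pq qs) orbT.
Qed.

(** Sorting reduces closure to equality of lists; as [lexlt] is strict, sortedness also excludes
    repetitions. *)
Definition group_check n (L gs : seq (seq nat)) : bool :=
  let S := sort lexlt L in
  [&& iota 0 n \in L, sorted lexlt S &
    all (fun c => sort lexlt [seq pcomp p c | p <- L] == S) gs].

Lemma group_checkP n (A : {set 'S_n}) gs L :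
    [seq code s | s in A] =i gs ->
    (forall p, p \in L -> exists2 s, s \in <<A>>%g & code s = p) ->
    group_check n L gs ->
  perm_eq [seq code s | s in <<A>>%g] L.
Proof.
move=> codeA L_gen /and3P[L1 L_sorted /allP L_closed].
apply: (perm_code_gen codeA) => // [|c /L_closed/eqP L_c p p_in].
  rewrite -(sort_uniq lexlt); exact: sorted_uniq lexlt_trans lexlt_irr _ L_sorted.
by rewrite -(mem_sort lexlt) -L_c mem_sort.
Qed.

(* fv lists the nonzero numbers of fixed points; the row of C for a row t of T  *)
(* lists the sums of t over the elements with each of these numbers.            *)
Definition multiplicity_check r (L : seq (seq nat)) (cls : seq nat -> nat)
    (T : seq (seq qint)) (fv : seq nat) (C : seq (seq int)) : bool :=
  [&& uniq (0 :: fv), all (fun p => pfix p \in 0 :: fv) L, size C == r &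
    let V := [seq tally r [seq cls p | p <- L & pfix p == f] | f <- fv] in
    all (fun tc => (size tc.2 == size fv) &&
        all (fun vc => qeq (qcomb vc.1 tc.1) (Z_of_int vc.2, Z0)) (zip V tc.2))
      (zip T C)].

Definition data_check n r N gs fs b rws T ds fv C : bool :=
  let L := product_list n gs fs in
  let reps := map (word n gs) rws in
  let t := class_trie b L reps in
  let cls := trie_find t in
  [&& all (fun f => all (gtn (size gs)) f.1) fs, size L == N, group_check n L gs,
    class_function_check n r L gs cls, representatives_check r L reps cls,
    shape_check r T ds, column_check r L T ds,
    convolution_check r L reps cls T ds & multiplicity_check r L cls T fv C].

(** * Multiplicities in tensor powers *)

Section Multiplicities.
Local Open Scope ring_scope.

Definition mult_poly (N : nat) (fv : seq nat) (c : seq int) (k : nat) : rat :=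
  (\sum_(fc <- zip fv c) fc.2%:~R * fc.1%:R ^+ k) / N%:R.

Lemma mxtrace_tens (K : comPzRingType) m p (M : 'M[K]_m) (M' : 'M[K]_p) :
  \tr (M *t M') = \tr M * \tr M'.
Proof. by rewrite /mxtrace mulr_sum; apply: eq_bigr => i _; rewrite mxE. Qed.

Lemma mxtrace_ntens (K : comPzRingType) m (M : 'M[K]_m) k :
  \tr (M ^t k) = \tr M ^+ k.
Proof.
case: k => [|k]; first by rewrite ntensmx0 mxtrace1 expn0.
elim: k => [|k IHk]; first by rewrite ntensmx1.
by rewrite ntensmxSS mxtrace_tens IHk -exprS.
Qed.

Lemma mxtrace_perm (K : comPzRingType) n (s : 'S_n) :
  \tr (perm_mx s : 'M[K]_n) = (pfix (code s))%:R.
Proof.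
rewrite pfix_code -sum1_card natr_sum big_mkcond; apply: eq_bigr => i _.
by rewrite !mxE /= inE; case: eqP.
Qed.

Lemma pfix_codeV n (s : 'S_n) : pfix (code s^-1%g) = pfix (code s).
Proof.
rewrite !pfix_code; apply: eq_card => x; rewrite !inE.
by rewrite (canF_eq (permKV s)) eq_sym.
Qed.

Variables (F : numClosedFieldType) (n r N : nat) (G : {group 'S_n}).
Variables (A : {set 'S_n}) (gs : seq (seq nat)) (fs : seq (seq nat * nat)).
Variables (b : nat) (rws : seq (seq nat)) (T : seq (seq qint)) (ds fv : seq nat).
Variable C : seq (seq int).

Hypothesis genG : G = <<A>>%G.
Hypothesis codeA : [seq code s | s in A] =i gs.
Hypothesis data_ok : data_check n r N gs fs b rws T ds fv C.

Theorem data_multiplicities : exists W : 'I_r -> irreps F G,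
  bijective W /\ forall i k, (0 < k)%N ->
    multiplicity (tens_perm_repr F G k) (W i) = ratr (mult_poly N fv (nth [::] C i) k).
Proof.
case/and5P: data_ok; set L := product_list n gs fs => fs_ok /eqP sizeL L_ok cls_ok.
set reps := map _ rws; set cls := trie_find _.
case/and5P => reps_ok shape_ok col_ok conv_ok mult_ok.
have permL : perm_eq [seq code s | s in G] L.
  rewrite genG; apply: group_checkP codeA _ L_ok => p.
  exact: (product_list_gen codeA).
have [W [bijW WP]] :=
  table_char_irreducible F genG codeA permL cls_ok reps_ok shape_ok col_ok conv_ok.
exists W; split=> // i k k_gt0.
have cardG : #|G| = N.
  rewrite -sizeL -(perm_size permL) size_map -cardE; exact: eq_card.
case/and4P: mult_ok => /andP[fv0 fv_uniq] fix_ok /eqP size_C mult_ok.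
case/and5P: shape_ok => /eqP size_T _ /allP row_T _ _.
have size_Ti : size (nth [::] T i) = r by apply/eqP/row_T; rewrite mem_nth ?size_T.
have /allP/(_ (nth ([::], [::]) (zip T C) i)) := mult_ok.
rewrite mem_nth ?size_zip ?size_T ?size_C ?minnn // => /(_ isT).
rewrite nth_zip ?size_T ?size_C //=; set c := nth [::] C i => /andP[/eqP size_c].
set V := map _ fv => /(all_nthP ([::], 0)) coef.
have size_V : size V = size c by rewrite size_map.
have cls_lt a : a \in L -> (cls a < r)%N.
  by move=> La; case/andP: cls_ok => /allP/(_ _ La)/andP[].
pose x p := qev F (nth qzero (nth [::] T i) (cls p)).
have coefE m : (m < size fv)%N ->
    \sum_(p <- L | pfix p == nth 0%N fv m) x p = (nth 0 c m)%:~R.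
  move=> m_lt; have := coef m; rewrite size_zip size_V minnn size_c => /(_ m_lt).
  rewrite nth_zip //= => /(qev_eq F); rewrite qev_int intZ_of_int.
  move=> <-; rewrite (nth_map 0%N) // (@qev_comb _ r) ?size_tally //; last first.
    by apply/allP => _ /mapP[p + ->]; rewrite mem_filter => /andP[_ /cls_lt].
  rewrite -(tally_sum (fun m => qev F (nth qzero (nth [::] T i) m))).
    by rewrite big_map big_filter.
  by apply/allP => _ /mapP[p + ->]; rewrite mem_filter => /andP[_ /cls_lt].
rewrite /multiplicity /mult_poly cardG fmorph_div /= ratr_nat mulrC; congr (_ / _).
transitivity (\sum_(p <- L) x p * (pfix p)%:R ^+ k).
  (* An element and its inverse have equally many fixed points, which removes the inverse in the
     character. *)
  rewrite -(perm_big _ permL) big_map big_enum /= (reindex_inj invg_inj) /=.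
  apply: eq_big => [s|s Gs]; first by rewrite groupV.
  have {}Gs : s \in G by rewrite groupV in Gs.
  rewrite invgK WP // /table_char -/cls; congr (_ * _).
  by rewrite /tens_perm_mx mxtrace_ntens mxtrace_perm pfix_codeV.
(* The sum is split by the number of fixed points; 0 is left out of [fv] since 0^k = 0 for k > 0. *)
rewrite (eq_big_seq (fun p => \sum_(m < size fv)
    if pfix p == nth 0%N fv m then x p * (nth 0%N fv m)%:R ^+ k else 0)); last first.
  move=> p /(allP fix_ok); rewrite inE => /orP[/eqP-> | fp].
    rewrite expr0n (gtn_eqF k_gt0) mulr0 big1 // => m _; case: eqP => // e.
    by case/negP: fv0; rewrite e mem_nth.
  rewrite (bigD1 (Ordinal (etrans (index_mem _ _) fp))) //= nth_index // eqxx.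
  rewrite big1 ?addr0 // => m nm; case: eqP => // e.
  by case/eqP: nm; apply: val_inj; rewrite /= e index_uniq.
rewrite exchange_big rmorph_sum (big_nth (0%N, 0)) size_zip size_c minnn big_mkord.
apply: eq_bigr => m _; rewrite nth_zip // -big_mkcond -mulr_suml coefE //=.
by rewrite rmorphM rmorphXn /= ratr_int ratr_nat.
Qed.

End Multiplicities.

Local Open Scope ring_scope.

(** The full list of degrees matches the formulas for k >= 2; the one without zeros is for k = 1. *)
Theorem data_centralizer (F : numClosedFieldType) n r N (A : {set 'S_n}) gs fs b rws
    T ds fv C k :
    [seq code s | s in A] =i gs -> data_check n r N gs fs b rws T ds fv C ->
    (0 < k)%N ->
  let iso := centralizer_iso_matsum (tens_perm_repr F <<A>>%G k) in
  exists ms : seq nat, [/\ [seq m%:R | m <- ms] = [seq mult_poly N fv c k | c <- C],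
    iso ms & iso [seq m <- ms | m != 0%N]].
Proof.
move=> codeA data_ok k_gt0 iso.
have [W [[W' WK W'K] WP]] := data_multiplicities F (erefl <<A>>%G) codeA data_ok.
have size_C : size C = r.
  by case/and5P: data_ok => _ _ _ _ /and5P[_ _ _ _] /and4P[_ _ /eqP].
have [m mE] : exists m : irreps F <<A>>%G -> nat,
    forall V, multiplicity (tens_perm_repr F <<A>>%G k) V = (m V)%:R.
  apply: (@fin_all_exists {: irreps F <<A>>%G} (fun=> nat) (fun V a =>
    multiplicity (tens_perm_repr F <<A>>%G k) V = a%:R)) => V.
  exact: multiplicity_nat.
have W_inj := can_inj WK.
have W_all V : V \in [seq W i | i <- enum 'I_r].
  by rewrite -(W'K V) map_f ?mem_enum.
have W_uniq : uniq [seq W i | i <- enum 'I_r] by rewrite map_inj_uniq ?enum_uniq.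
exists [seq m V | V <- [seq W i | i <- enum 'I_r]]; split.
- rewrite -!map_comp -[C in RHS](mkseq_nth [::]) /mkseq size_C -val_enum_ord -!map_comp.
  apply: eq_map => i /=; apply: (fmorph_inj (@ratr F)).
  by rewrite /= ratr_nat -mE WP.
- by apply: centralizer_iso_seq => // V; rewrite W_all.
rewrite filter_map; apply: centralizer_iso_seq => //; first exact: filter_uniq.
by move=> V; rewrite mem_filter W_all andbT => /negPn/eqP.
Qed.

(** * The two groups of order 1344 *)

Local Open Scope nat_scope.

Definition cycles_G :=
  [:: [:: [:: 5; 7]; [:: 6; 8]]; [:: [:: 2; 3; 5]; [:: 4; 7; 6]];
      [:: [:: 1; 2]; [:: 3; 4]; [:: 5; 6]; [:: 7; 8]];
      [:: [:: 1; 5]; [:: 2; 6]; [:: 3; 7]; [:: 4; 8]]].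
Definition codes_G := map (nat_cycles 7) cycles_G.
(* The words of the factors and of the representatives come from a computer     *)
(* search; group_check and representatives_check certify them.                  *)
Definition factors_G :=
  [:: ([:: 3; 0], 4); ([:: 1; 1; 0; 1; 2], 4); ([:: 0; 1; 1; 0; 2; 1], 4);
      ([:: 1; 0; 1; 0; 1; 0; 1; 1; 0], 3); ([:: 1; 0; 1; 0; 2], 7)].
Definition reps_G :=
  [:: [::]; [:: 2]; [:: 0]; [:: 0; 2]; [:: 1]; [:: 0; 3]; [:: 0; 1; 0; 1; 1];
      [:: 0; 1; 0; 1; 1; 3]; [:: 1; 2]; [:: 0; 1; 1]; [:: 0; 1]].
Definition degrees_G := [:: 1; 3; 3; 6; 7; 7; 8; 7; 14; 21; 21].

Local Delimit Scope Z_scope with BZ.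
Definition int_row (s : seq Z) : seq qint := [seq (z, Z0) | z <- s].
(** alpha and its conjugate -1 - alpha, the values on the two classes of elements of order 7. *)
Definition qalpha : seq qint := [:: (0, 1); (-1, -1)]%BZ.
Definition qalpha' : seq qint := [:: (-1, -1); (0, 1)]%BZ.

(* Rows in the order of degG, columns in the order of reps_G. *)
Definition table_G : seq (seq qint) :=
  [:: int_row [:: 1; 1; 1; 1; 1; 1; 1; 1; 1; 1; 1]%BZ;
      int_row [:: 3; 3; -1; -1; 0; -1; 1; 1; 0]%BZ ++ qalpha;
      int_row [:: 3; 3; -1; -1; 0; -1; 1; 1; 0]%BZ ++ qalpha';
      int_row [:: 6; 6; 2; 2; 0; 2; 0; 0; 0; -1; -1]%BZ;
      int_row [:: 7; 7; -1; -1; 1; -1; -1; -1; 1; 0; 0]%BZ;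
      int_row [:: 7; -1; -1; 3; 1; -1; -1; 1; -1; 0; 0]%BZ;
      int_row [:: 8; 8; 0; 0; -1; 0; 0; 0; -1; 1; 1]%BZ;
      int_row [:: 7; -1; 3; -1; 1; -1; 1; -1; -1; 0; 0]%BZ;
      int_row [:: 14; -2; 2; 2; -1; -2; 0; 0; 1; 0; 0]%BZ;
      int_row [:: 21; -3; -3; 1; 0; 1; 1; -1; 0; 0; 0]%BZ;
      int_row [:: 21; -3; 1; -3; 0; 1; -1; 1; 0; 0; 0]%BZ].

(** 1344 times the coefficients of 8^k, 4^k, 2^k and 1 in the degrees. *)
Definition coef_G : seq (seq int) :=
  [:: [:: 1; 42; 392; 384]%Z;
      [:: 3; -42; 168; -192]%Z;
      [:: 3; -42; 168; -192]%Z;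
      [:: 6; 84; 0; -384]%Z;
      [:: 7; -42; 56; 0]%Z;
      [:: 7; -42; 56; 0]%Z;
      [:: 8; 0; -224; 384]%Z;
      [:: 7; 126; 392; 0]%Z;
      [:: 14; 84; -224; 0]%Z;
      [:: 21; -126; 168; 0]%Z;
      [:: 21; 42; -168; 0]%Z].

Definition cycles_H :=
  [:: [:: [:: 1; 2; 3; 4; 5; 6; 7]; [:: 14; 13; 12; 11; 10; 9; 8]];
      [:: [:: 1; 4; 7; 9; 14; 11; 8; 6]; [:: 2; 5; 13; 10]]].
Definition codes_H := map (nat_cycles 13) cycles_H.
Definition factors_H :=
  [:: ([:: 1; 0; 1; 1; 0; 1], 2); ([:: 1; 1; 0; 1; 1; 1], 4);
      ([:: 0; 1; 0; 0; 1; 0; 1], 8); ([:: 1; 0; 1; 0; 0; 0], 3);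
      ([:: 0; 1; 0; 1; 1; 0; 1], 7)].
Definition reps_H :=
  [:: [::]; [:: 1; 1; 1; 1]; [:: 0; 0; 0; 1; 1; 1]; [:: 0; 0; 1; 1];
      [:: 0; 1; 0; 1]; [:: 1; 1]; [:: 0; 0; 0; 1]; [:: 0]; [:: 0; 0; 0];
      [:: 0; 1]; [:: 1]].

(* Rows in the order of degH, columns in the order of reps_H. *)
Definition table_H : seq (seq qint) :=
  [:: int_row [:: 1; 1; 1; 1; 1; 1; 1; 1; 1; 1; 1]%BZ;
      int_row [:: 3; 3; -1; 0; -1; -1; 0]%BZ ++ qalpha ++ int_row [:: 1; 1]%BZ;
      int_row [:: 3; 3; -1; 0; -1; -1; 0]%BZ ++ qalpha' ++ int_row [:: 1; 1]%BZ;
      int_row [:: 6; 6; 2; 0; 2; 2; 0; -1; -1; 0; 0]%BZ;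
      int_row [:: 7; 7; -1; 1; -1; -1; 1; 0; 0; -1; -1]%BZ;
      int_row [:: 8; 8; 0; -1; 0; 0; -1; 1; 1; 0; 0]%BZ;
      int_row [:: 7; -1; -1; 1; 3; -1; -1; 0; 0; -1; 1]%BZ;
      int_row [:: 7; -1; -1; 1; -1; 3; -1; 0; 0; 1; -1]%BZ;
      int_row [:: 14; -2; -2; -1; 2; 2; 1; 0; 0; 0; 0]%BZ;
      int_row [:: 21; -3; 1; 0; 1; -3; 0; 0; 0; 1; -1]%BZ;
      int_row [:: 21; -3; 1; 0; -3; 1; 0; 0; 0; -1; 1]%BZ].
Definition degrees_H := [:: 1; 3; 3; 6; 7; 8; 7; 7; 14; 21; 21].

(** 1344 times the coefficients of 14^k, 6^k and 2^k in the degrees. *)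
Definition coef_H : seq (seq int) :=
  [:: [:: 1; 49; 518]%Z;
      [:: 3; -21; 42]%Z;
      [:: 3; -21; 42]%Z;
      [:: 6; 126; 252]%Z;
      [:: 7; 7; -70]%Z;
      [:: 8; 56; -224]%Z;
      [:: 7; 119; 266]%Z;
      [:: 7; -49; 98]%Z;
      [:: 14; 70; -308]%Z;
      [:: 21; 21; -210]%Z;
      [:: 21; -147; 294]%Z].

Lemma data_G_ok :
  data_check 8 11 1344 codes_G factors_G 5 reps_G table_G degrees_G
    [:: 8; 4; 2; 1] coef_G.
Proof. by vm_compute. Qed.

Lemma data_H_ok :
  data_check 14 11 1344 codes_H factors_H 3 reps_H table_H degrees_H
    [:: 14; 6; 2] coef_H.
Proof. by vm_compute. Qed.

Local Open Scope ring_scope.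

Lemma degG_poly k : [seq mult_poly 1344 [:: 8; 4; 2; 1]%N c k | c <- coef_G] = degG k.
Proof.
have p8 : 8%:R ^+ k = 2 ^+ (3 * k) :> rat by rewrite exprM.
have p4 : 4%:R ^+ k = 2 ^+ (2 * k) :> rat by rewrite exprM.
rewrite /degG /mult_poly /= !big_cons !big_nil /= p8 p4 expr1n.
rewrite /cG /gG /aG /bG /dG /eG /fG /hG /iG /jG /lG.
by do 11![apply: (congr2 cons); first by field].
Qed.

Lemma degH_poly k : [seq mult_poly 1344 [:: 14; 6; 2]%N c k | c <- coef_H] = degH k.
Proof.
have p14 : 14%:R ^+ k = 2 ^+ k * 7 ^+ k :> rat by rewrite -exprMn.
have p6 : 6%:R ^+ k = 2 ^+ k * 3 ^+ k :> rat by rewrite -exprMn.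
rewrite /degH /mult_poly /= !big_cons !big_nil /= p14 p6.
rewrite /cH /aH /bH /dH /eH /fH /gH /hH /iH /jH /lH.
by do 11![apply: (congr2 cons); first by field].
Qed.

Lemma natr_map_inj : injective (map (fun m : nat => m%:R : rat)).
Proof. by apply: inj_map => m p /eqP; rewrite eqr_nat => /eqP. Qed.

Theorem theorem3p2 (R : realType) (k : nat) (hk : (1 <= k)%N) :
  let AG := tens_perm_repr R[i] group_G k in
  let AH := tens_perm_repr R[i] group_H k in
  ((k = 1%N -> centralizer_iso_matsum AG [:: 1%N; 1%N]) /\
   ((2 <= k)%N -> exists ds : seq nat,
      [seq d%:R | d <- ds] = degG k /\ centralizer_iso_matsum AG ds)) /\
  ((k = 1%N -> centralizer_iso_matsum AH [:: 1%N; 1%N; 1%N]) /\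
   ((2 <= k)%N -> exists ds : seq nat,
      [seq d%:R | d <- ds] = degH k /\ centralizer_iso_matsum AH ds)).
Proof.
move=> AG AH; split.
  have codeA : [seq code s | s in gens_G] =i codes_G.
    by apply: (@code_cycles_set 7) => // s; rewrite !inE -!orbA.
  have [ms [msE iso_ms iso_ms']] := data_centralizer R[i] codeA data_G_ok hk.
  rewrite degG_poly in msE; split=> [k1 | _]; last by exists ms.
  (* The permutation character of degree 8 is 1 plus an irreducible of degree 7. *)
  move: iso_ms'; have -> : ms = [:: 1; 0; 0; 0; 0; 0; 0; 1; 0; 0; 0]%N.
    apply: natr_map_inj; rewrite msE k1 /degG.
    rewrite /cG /gG /aG /bG /dG /eG /fG /hG /iG /jG /lG /=.
    by do 11![apply: (congr2 cons); first by field].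
  exact.
have codeA : [seq code s | s in gens_H] =i codes_H.
  by apply: (@code_cycles_set 13) => // s; rewrite !inE.
have [ms [msE iso_ms iso_ms']] := data_centralizer R[i] codeA data_H_ok hk.
rewrite degH_poly in msE; split=> [k1 | _]; last by exists ms.
(* Here 14 = 1 + 6 + 7. *)
move: iso_ms'; have -> : ms = [:: 1; 0; 0; 1; 0; 0; 1; 0; 0; 0; 0]%N.
  apply: natr_map_inj; rewrite msE k1 /degH.
  rewrite /cH /aH /bH /dH /eH /fH /gH /hH /iH /jH /lH /=.
  by do 11![apply: (congr2 cons); first by field].
exact.
Qed.
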